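(* Let $X$ be a smooth complex projective variety of complex dimension $m$ and $n\ge2$. The space $E_*^*(w(X,n))$ is an acyclic, $\mathcal{S}_n$-invariant subcomplex of the Kriz model $(E_*^*(X,n),d)$.
   Context: $X$ is connected of complex dimension $m\ge1$, $H^*(X)=H^*(X;\mathbb{Q})$, and $\mathcal{B}=\{x_1=1\prec\dots\prec x_B=w\}$ is a fixed homogeneous ordered basis of $H^*(X)$ with nondecreasing degrees, $w\in H^{2m}(X)$ the fundamental class. $\Delta=w\otimes1+\dots+1\otimes w\in H^*(X)\otimes H^*(X)\cong H^*(X^2)$ is the class of the diagonal; $p_i^*:H^*(X)\to H^*(X^n)$, $p_{ij}^*:H^*(X^2)\to H^*(X^n)$ are the pullbacks along the projections. Kriz model $E(X,n)=E_*^*(X,n)$: the graded-commutative algebra obtained from the exterior algebra with generators $G_{ij}$ ($1\le i\neq j\le n$) of degree $2m-1$ and coefficients in $H^*(X)^{\otimes n}$, modulo $G_{ji}=G_{ij}$; $p_j^*(x)G_{ij}=p_i^*(x)G_{ij}$ ($i<j$, $x\in H^*(X)$); $G_{ik}G_{jk}=G_{ij}G_{jk}-G_{ij}G_{ik}$ ($i<j<k$); with derivation $d$, $d|_{H^*(X)^{\otimes n}}=0$, $d(G_{ij})=p_{ij}^*(\Delta)$. $E_q^k$ is the part with $q$ exterior generators and total degree $k$; $d:E_q^k\to E_{q-1}^{k+1}$. $\mathcal{S}_n$ acts by algebra automorphisms with $\sigma(p_i^*(x))=p_{\sigma(i)}^*(x)$, $\sigma(G_{ij})=G_{\sigma(i)\sigma(j)}$.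 For sequences $I_*=(i_1,\dots,i_q)$, $J_*=(j_1,\dots,j_q)$ with $i_a<j_a$ and $j_1<\dots<j_q$ write $G_{I_*J_*}=G_{i_1j_1}\cdots G_{i_qj_q}$; $I_*,J_*$ are also regarded as sets. For $A\subset\{1,\dots,n\}$ with $|A|=a\ge2$ and a sequence $\beta=(y_1,\dots,y_b)$ of length $b=n-a$ of elements of $\mathcal{B}\setminus\{w\}$, let $b_1<\dots<b_b$ be the elements of $\{1,\dots,n\}\setminus A$, $p^*(\beta)=\prod_{j=1}^bp_{b_j}^*(y_j)$, $|\beta|=\sum_j\deg y_j$, and $$E_q^{2ma-q+|\beta|}(A,\beta)=\mathbb{Q}\Big\langle\prod_{i\in A\setminus J_*}p_i^*(w)\,p^*(\beta)\,G_{I_*J_*}\ \Big|\ I_*\cup J_*\subset A,\ |J_*|=q\Big\rangle,\qquad E_*^{Top}(A,\beta)=\sum_{q=0}^{a-1}E_q^{2ma-q+|\beta|}(A,\beta).$$ Two sequences $\beta,\beta'$ of length $b$ are similar, $\beta\sim\beta'$, if one is obtained from the other by a permutation of its terms. Set $$E_*^{Top}(a,\beta)=\sum_{|A|=a,\ \beta'\sim\beta}E_*^{Top}(A,\beta'),\qquad E_*^*(w(X,n))=\sum_{a=2}^n\ \sum_{\beta\text{ of length }n-a}E_*^{Top}(a,\beta).$$ *)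

(* Defs.v *)
From HB Require Import structures.
From mathcomp Require Import all_boot all_order all_algebra all_fingroup all_field.
From mathcomp Require Import boolp finmap monalg.

Set Implicit Arguments.
Unset Strict Implicit.
Unset Printing Implicit Defensive.

Import GRing.Theory.
Local Open Scope ring_scope.
Local Open Scope quotient_scope.

(* The rational cohomology algebra of a connected smooth complex projective
   variety of complex dimension m: a finite-dimensional, connected,
   graded-commutative Q-algebra satisfying Poincare duality in dimension 2m. *)
Record cohomology_ring (m : nat) := CohomologyRing {
  coh_alg :> falgType rat;
  coh : nat -> {vspace coh_alg};
  coh_sum : (\sum_(k < m.*2.+1) coh k)%VS = fullv;
  coh_direct : directv (\sum_(k < m.*2.+1) coh k);
  coh_gt : forall k, (m.*2 < k)%N -> coh k = 0%VS;
  coh_conn : coh 0 = 1%VS;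
  coh_mul : forall k l, (coh k * coh l <= coh (k + l))%VS;
  coh_comm : forall k l x y, x \in coh k -> y \in coh l ->
    x * y = (-1) ^+ (k * l) * (y * x);
  coh_top : \dim (coh m.*2) = 1%N;
  coh_duality : forall k l x, (k + l)%N = m.*2 -> x \in coh k -> x != 0 ->
    exists2 y, y \in coh l & x * y != 0
}.

(* The projection H -> H^0 = Q; it shows that 1 != 0 in the Kriz model. *)
Section Augmentation.
Variables (m : nat) (H : cohomology_ring m).

Let pr (k : 'I_m.*2.+1) : H -> H :=
  sumv_pi (\sum_(k < m.*2.+1) coh H k)%VS k.

Let prE j x (k : 'I_m.*2.+1) : x \in coh H j ->
  pr k x = if j == k then x else 0.
Proof.
move=> xj; have [ltj|] := ltnP j m.*2.+1; last first.
  move=> gtj; have: x \in coh H j by [].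
  rewrite coh_gt // memv0 => /eqP ->.
  by rewrite if_same /pr linear0.
have dx := coh_direct H.
have /directv_sum_unique := dx => /(_ (fun k => pr k x)
  (fun k : 'I_m.*2.+1 => if j == k then x else 0)).
have h1 : forall i : 'I_m.*2.+1, true -> pr i x \in coh H i.
  by move=> i _; apply: memv_sum_pi.
have h2 : forall i : 'I_m.*2.+1, true ->
    (if j == i then x else 0) \in coh H i.
  by move=> i _; case: eqP => [<-|] //; rewrite mem0v.
move=> /(_ h1 h2).
have xfull : x \in (\sum_(k < m.*2.+1) coh H k)%VS by rewrite coh_sum memvf.
rewrite (sumv_pi_sum (erefl _) xfull).
rewrite (bigD1 (Ordinal ltj)) //= eqxx big1 ?addr0 ?eqxx; last first.
  by move=> i ni; case: eqP => // ji; case/eqP: ni; apply: val_inj.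
by move=> /esym/forall_inP/(_ k isT)/eqP.
Qed.

Lemma augmentation_exists : exists e : H -> rat,
  [/\ e 1 = 1, forall a x y, e (a *: x + y) = a * e x + e y,
      forall x y, e (x * y) = e x * e y &
      forall k x, (0 < k)%N -> x \in coh H k -> e x = 0].
Proof.
pose e x : rat := coord [tuple (1 : H)] ord0 (pr ord0 x).
have oneE c : coord [tuple (1 : H)] ord0 (c *: 1) = c.
  have f1 : free [tuple (1 : H)] by rewrite seq1_free oner_neq0.
  by rewrite linearZ /= (coord_free ord0 ord0 f1) eqxx mulr1.
have h0 x : pr ord0 x = e x *: 1.
  have : pr ord0 x \in coh H 0 by apply: memv_sum_pi.
  by rewrite coh_conn => /vlineP[c]; rewrite /e => ->; rewrite oneE.
have o1 : (1 : H) \in coh H 0 by rewrite coh_conn memv_line.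
have dec z : z = \sum_k pr k z by rewrite sumv_pi_sum ?coh_sum ?memvf.
have prD : {morph pr ord0 : x y / x + y} by move=> x y; rewrite /pr linearD.
have pr0 : pr ord0 0 = 0 by rewrite /pr linear0.
exists e; split=> [|a x y|x y|k x k0 xk].
- by rewrite /e (prE _ o1) /= -[X in coord _ _ X]scale1r oneE.
- by rewrite /e /pr !linearP.
- have prM : pr ord0 (x * y) = pr ord0 x * pr ord0 y.
    rewrite {1}[x]dec {1}[y]dec mulr_suml (big_morph _ prD pr0).
    rewrite (bigD1 ord0) //= [X in _ + X]big1 ?addr0 => [|i i0]; last first.
      rewrite mulr_sumr (big_morph _ prD pr0) big1 // => j _.
      rewrite (@prE (i + j)) /=.
        rewrite addn_eq0; case: eqP => //= i0'; case/eqP: i0.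
        exact: val_inj.
      by apply: (subvP (coh_mul H i j)); rewrite memv_mul ?memv_sum_pi.
    rewrite mulr_sumr (big_morph _ prD pr0) (bigD1 ord0) //=.
    rewrite [X in _ + X]big1 ?addr0 => [|i i0].
      rewrite (@prE 0) //; apply: (subvP (coh_mul H 0 0)).
      by rewrite memv_mul // memv_sum_pi.
    rewrite (@prE (0 + i)) /=.
      by rewrite add0n; case: eqP => // i0'; case/eqP: i0; apply: val_inj.
    by apply: (subvP (coh_mul H 0 i)); rewrite memv_mul ?memv_sum_pi.
  by rewrite {1}/e prM !h0 -scalerAl mul1r scalerA oneE.
- by rewrite /e (prE _ xk) /= eqn0Ngt k0 /= linear0.
Qed.

End Augmentation.

Section RatMorphism.
Variables (A : nzRingType) (ev : {rmorphism A -> rat}).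

Lemma rat_morph_comm u v c a b : ev u = a -> ev v = b ->
  ev (u * v - (-1) ^+ c * (v * u)) = a * b - (-1) ^+ c * (b * a).
Proof. by move=> <- <-; rewrite rmorphB !rmorphM rmorphXn rmorphN1. Qed.

Lemma rat_morph_anticomm u v : ev u = 0 -> ev (u * v + v * u) = 0.
Proof. by move=> u0; rewrite rmorphD !rmorphM u0 mul0r mulr0 addr0. Qed.

Lemma rat_morph_M0 u v : ev v = 0 -> ev (u * v) = 0.
Proof. by move=> v0; rewrite rmorphM v0 mulr0. Qed.

Lemma rat_morph_0M u v : ev u = 0 -> ev (u * v) = 0.
Proof. by move=> u0; rewrite rmorphM u0 mul0r. Qed.

Lemma rat_morph_B0 u v : ev u = ev v -> ev (u - v) = 0.
Proof. by move=> uv; rewrite rmorphB uv subrr. Qed.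

Lemma rat_morph_BM u v w a b : ev w = a * b -> ev u = a -> ev v = b ->
  ev (w - u * v) = 0.
Proof. by move=> w_ab ua vb; rewrite rmorphB rmorphM w_ab ua vb subrr. Qed.

End RatMorphism.

Section KrizModel.
Variables (m : nat) (H : cohomology_ring m) (n : nat).

(* Letters of the presentation: inl (i, x) stands for p_i^* x and inr (i, j)
   for G_ij. *)
Definition kriz_letter := ('I_n * H + 'I_n * 'I_n)%type.

Definition kriz_free := {malg rat[{fmonom kriz_letter}]}.

Definition free_p (i : 'I_n) (x : H) : kriz_free := mkmalgU (fmu (inl (i, x))) 1.
Definition free_G (i j : 'I_n) : kriz_free := mkmalgU (fmu (inr (i, j))) 1.

(* The relations [rel_lin] .. [rel_pp] present H^{\otimes n}, the product of n
   copies of H in graded-commutative algebras, with p_i^* x the tensor having x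
   in position i and 1 elsewhere; [rel_pG] and [rel_GG] then present the
   exterior algebra on the G_ij, of degree 2m-1, over it.  There is no
   generator G_ii, whence [rel_G_diag]. *)
Inductive kriz_rel : kriz_free -> Prop :=
| rel_lin i a x y :
    kriz_rel (free_p i (a *: x + y) - (a *: free_p i x + free_p i y))
| rel_one i : kriz_rel (free_p i 1 - 1)
| rel_mul i x y : kriz_rel (free_p i (x * y) - free_p i x * free_p i y)
| rel_pp i j k l x y : x \in coh H k -> y \in coh H l ->
    kriz_rel (free_p i x * free_p j y
              - (-1) ^+ (k * l) * (free_p j y * free_p i x))
| rel_pG i j h k x : x \in coh H k ->
    kriz_rel (free_p i x * free_G j h
              - (-1) ^+ (k * m.*2.-1) * (free_G j h * free_p i x))
| rel_GG i j h l :
    kriz_rel (free_G i j * free_G h l + free_G h l * free_G i j)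
| rel_G_diag i : kriz_rel (free_G i i)
| rel_G_sym i j : kriz_rel (free_G j i - free_G i j)
| rel_p_G (i j : 'I_n) x : (i < j)%N ->
    kriz_rel (free_p j x * free_G i j - free_p i x * free_G i j)
| rel_arnold (i j k : 'I_n) : (i < j)%N -> (j < k)%N ->
    kriz_rel (free_G i k * free_G j k
              - (free_G i j * free_G j k - free_G i j * free_G i k)).

Inductive kriz_ideal : kriz_free -> Prop :=
| ideal_rel u : kriz_rel u -> kriz_ideal u
| ideal_0 : kriz_ideal 0
| ideal_B u v : kriz_ideal u -> kriz_ideal v -> kriz_ideal (u - v)
| ideal_Ml a u : kriz_ideal u -> kriz_ideal (a * u)
| ideal_Mr a u : kriz_ideal u -> kriz_ideal (u * a).

Definition kriz_idealb : {pred kriz_free} := fun u => `[< kriz_ideal u >].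

Fact kriz_idealb_zmod : zmod_closed kriz_idealb.
Proof.
split=> [|u v /asboolP iu /asboolP iv]; apply/asboolP; first exact: ideal_0.
exact: ideal_B.
Qed.

HB.instance Definition _ :=
  GRing.isZmodClosed.Build kriz_free kriz_idealb kriz_idealb_zmod.

Definition kriz_idealz := GRing.ZmodClosed.clone kriz_free kriz_idealb _.

Definition kriz : Type := Quotient.quot kriz_idealz.
HB.instance Definition _ := GRing.Zmodule.on kriz.

Definition kriz_pi (u : kriz_free) : kriz := \pi_(Quotient.quot kriz_idealz) u.
Definition kriz_repr (x : kriz) : kriz_free :=
  generic_quotient.repr (x : Quotient.quot kriz_idealz).

Lemma kriz_reprK : cancel kriz_repr kriz_pi.
Proof. by move=> x; rewrite /kriz_pi /kriz_repr reprK. Qed.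

Lemma kriz_pi_eq u v : kriz_pi u = kriz_pi v <-> kriz_ideal (u - v).
Proof.
have <- : (u - v \in kriz_idealz) <-> kriz_ideal (u - v).
  by split=> [/asboolP|iuv] //; apply/asboolP.
by rewrite Quotient.idealrBE; split=> [uv|/eqP]; [apply/eqP|].
Qed.

Lemma kriz_piB u v : kriz_pi (u - v) = kriz_pi u - kriz_pi v.
Proof. by rewrite /kriz_pi !raddfB. Qed.

Lemma kriz_piD u v : kriz_pi (u + v) = kriz_pi u + kriz_pi v.
Proof. by rewrite /kriz_pi !raddfD. Qed.

Definition kriz_one : kriz := kriz_pi 1.

(* Locked, lest a failed unification in kriz unfold to products in malg. *)
Fact kriz_key : unit. Proof. by []. Qed.
Definition kriz_mul : kriz -> kriz -> kriz :=
  locked_with kriz_key (fun x y => kriz_pi (kriz_repr x * kriz_repr y)).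
Definition kriz_scale : rat -> kriz -> kriz :=
  locked_with kriz_key (fun a x => kriz_pi (a *: kriz_repr x)).

Lemma kriz_piM u v : kriz_pi (u * v) = kriz_mul (kriz_pi u) (kriz_pi v).
Proof.
rewrite /kriz_mul unlock; apply/kriz_pi_eq.
set u' := kriz_repr _; set v' := kriz_repr _.
have iu : kriz_ideal (u - u') by apply/kriz_pi_eq; rewrite kriz_reprK.
have iv : kriz_ideal (v' - v) by apply/kriz_pi_eq; rewrite kriz_reprK.
have -> : u * v - u' * v' = (u - u') * v - u' * (v' - v).
  by rewrite mulrBl mulrBr opprB addrA addrNK.
by apply: ideal_B; [apply: ideal_Mr | apply: ideal_Ml].
Qed.

Lemma kriz_piZ a u : kriz_pi (a *: u) = kriz_scale a (kriz_pi u).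
Proof.
rewrite /kriz_scale unlock; apply/kriz_pi_eq; rewrite -scalerBr -mul_malgC; apply: ideal_Ml.
by apply/kriz_pi_eq; rewrite kriz_reprK.
Qed.

Fact kriz_mulA : associative kriz_mul.
Proof.
move=> x y z; rewrite -[x]kriz_reprK -[y]kriz_reprK -[z]kriz_reprK.
by rewrite -!kriz_piM mulrA.
Qed.

Fact kriz_mul1l : left_id kriz_one kriz_mul.
Proof. by move=> x; rewrite -[x]kriz_reprK -kriz_piM mul1r. Qed.

Fact kriz_mul1r : right_id kriz_one kriz_mul.
Proof. by move=> x; rewrite -[x]kriz_reprK -kriz_piM mulr1. Qed.

Fact kriz_mulDl : left_distributive kriz_mul +%R.
Proof.
move=> x y z; rewrite -[x]kriz_reprK -[y]kriz_reprK -[z]kriz_reprK.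
by rewrite -kriz_piD -!kriz_piM mulrDl kriz_piD.
Qed.

Fact kriz_mulDr : right_distributive kriz_mul +%R.
Proof.
move=> x y z; rewrite -[x]kriz_reprK -[y]kriz_reprK -[z]kriz_reprK.
by rewrite -kriz_piD -!kriz_piM mulrDr kriz_piD.
Qed.

Fact kriz_one_neq0 : kriz_one != 0.
Proof.
have [e [e1 eP eM e0]] := augmentation_exists H.
pose l (g : kriz_letter) : rat := if g is inl (_, x) then e x else 0.
pose h (w : {fmonom kriz_letter}) : rat := \prod_(g <- (w : seq _)) l g.
have hM : mmorphism h.
  split=> [w1 w2|]; first by rewrite /h fmM big_cat.
  by rewrite /h fm1 big_nil.
pose hB := isMultiplicative.Build _ _ h hM.
pose hh : {mmorphism {fmonom kriz_letter} -> rat} := HB.pack h hB.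
pose ev : {rmorphism kriz_free -> rat} := mmap idfun hh.
have evZD a u v : ev (a *: u + v) = a * ev u + ev v.
  by rewrite rmorphD; congr (_ + _); apply: mmapZ.
have evp i x : ev (free_p i x) = e x.
  by rewrite /= mmapU mul1r /= /h fmU big_seq1.
have evG i j : ev (free_G i j) = 0.
  by rewrite /= mmapU mul1r /= /h fmU big_seq1.
clearbody ev; clear hh hB hM h l.
have ev_ideal u : kriz_ideal u -> ev u = 0.
  elim=> {u} [u|||a u _|a u _].
  - case=> [i a x y|i|i x y|i j k q x y xk yl|i j h k x _|i j h q|i|i j|i j x _
           |i j k _ _].
    + apply: rat_morph_B0; rewrite evp eP.
      by apply/esym; apply: etrans (evZD _ _ _) _; rewrite !evp.
    + by apply: rat_morph_B0; rewrite evp e1 rmorph1.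
    + by apply: (rat_morph_BM (a := e x) (b := e y)); rewrite evp.
    + rewrite (rat_morph_comm _ (evp i x) (evp j y)) (mulrC (e y)).
      case: (posnP k) => [->|k0]; first by rewrite mul0n expr0 mul1r subrr.
      by rewrite (e0 _ _ k0 xk) mul0r mulr0 subr0.
    + by rewrite (rat_morph_comm _ (evp i x) (evG j h)) mul0r 2!mulr0 subr0.
    + exact: rat_morph_anticomm (evG i j).
    + exact: evG.
    + by apply: rat_morph_B0; rewrite 2!evG.
    + exact: rat_morph_B0 (etrans (rat_morph_M0 _ (evG i j))
        (esym (rat_morph_M0 _ (evG i j)))).
    + apply: rat_morph_B0; apply: (etrans (rat_morph_M0 _ (evG j k))).
      apply/esym/rat_morph_B0.
      exact: etrans (rat_morph_0M _ (evG i j)) (esym (rat_morph_0M _ (evG i j))).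
  - exact: rmorph0.
  - by move=> u v _ eu _ ev'; apply: rat_morph_B0; rewrite eu ev'.
  - exact: rat_morph_M0.
  - exact: rat_morph_0M.
apply/eqP=> one0.
have : kriz_ideal (1 - 0) by apply/kriz_pi_eq; rewrite -/kriz_one one0 /kriz_pi raddf0.
by rewrite subr0 => /ev_ideal; rewrite rmorph1 => /eqP; rewrite oner_eq0.
Qed.

HB.instance Definition _ := GRing.Zmodule_isNzRing.Build kriz
  kriz_mulA kriz_mul1l kriz_mul1r kriz_mulDl kriz_mulDr kriz_one_neq0.

Fact kriz_scaleA a b x : kriz_scale a (kriz_scale b x) = kriz_scale (a * b) x.
Proof. by rewrite -[x]kriz_reprK -!kriz_piZ scalerA. Qed.

Fact kriz_scale1 : left_id 1 kriz_scale.
Proof. by move=> x; rewrite -[x]kriz_reprK -kriz_piZ scale1r. Qed.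

Fact kriz_scaleDr : right_distributive kriz_scale +%R.
Proof.
move=> a x y; rewrite -[x]kriz_reprK -[y]kriz_reprK.
by rewrite -kriz_piD -!kriz_piZ scalerDr kriz_piD.
Qed.

Fact kriz_scaleDl x : {morph kriz_scale^~ x : a b / a + b}.
Proof. by move=> a b; rewrite -[x]kriz_reprK -!kriz_piZ scalerDl kriz_piD. Qed.

HB.instance Definition _ := GRing.Zmodule_isLmodule.Build rat kriz
  kriz_scaleA kriz_scale1 kriz_scaleDr kriz_scaleDl.

Fact kriz_scaleAl (a : rat) (x y : kriz) : a *: (x * y) = (a *: x) * y.
Proof.
rewrite -[x]kriz_reprK -[y]kriz_reprK -[LHS]/(kriz_scale _ (kriz_mul _ _)).
by rewrite -[RHS]/(kriz_mul (kriz_scale _ _) _) -kriz_piZ -!kriz_piM -kriz_piZ scalerAl.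
Qed.

HB.instance Definition _ := GRing.Lmodule_isLalgebra.Build rat kriz kriz_scaleAl.

Fact free_scaleAr (a : rat) (u v : kriz_free) : a *: (u * v) = u * (a *: v).
Proof.
rewrite [u * v]malgME [u * (a *: v)](malgMEw (fsubset_refl _) (msuppZ_le _ _)).
rewrite scaler_sumr; apply: eq_bigr => /= i _; rewrite scaler_sumr.
apply: eq_bigr => /= j _; apply/malgP => k.
rewrite 2!mcoeffZ; apply: etrans (congr1 _ (mcoeffU _ _ _)) _.
by apply: etrans _ (esym (mcoeffU _ _ _)); rewrite mulrnAr mulrCA.
Qed.

Fact kriz_scaleAr (a : rat) (x y : kriz) : a *: (x * y) = x * (a *: y).
Proof.
rewrite -[x]kriz_reprK -[y]kriz_reprK -[LHS]/(kriz_scale _ (kriz_mul _ _)).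
rewrite -[RHS]/(kriz_mul _ (kriz_scale _ _)) -kriz_piZ -!kriz_piM -kriz_piZ.
by rewrite free_scaleAr.
Qed.

HB.instance Definition _ := GRing.Lalgebra_isAlgebra.Build rat kriz kriz_scaleAr.

Definition kriz_p (i : 'I_n) (x : H) : kriz := kriz_pi (free_p i x).
Definition kriz_G (i j : 'I_n) : kriz := kriz_pi (free_G i j).

Definition lspan (V : lmodType rat) (S : V -> Prop) (x : V) : Prop :=
  exists2 s : seq (rat * V),
    (forall c, c \in s -> S c.2) & x = \sum_(c <- s) c.1 *: c.2.

Inductive kriz_monomial : nat -> nat -> kriz -> Prop :=
| monomial_1 : kriz_monomial 0 0 1
| monomial_p q k i l x e : x \in coh H l -> kriz_monomial q k e ->
    kriz_monomial q (l + k) (kriz_p i x * e)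
| monomial_G q k i j e : kriz_monomial q k e ->
    kriz_monomial q.+1 (m.*2.-1 + k) (kriz_G i j * e).

(* E_q^k: q exterior generators, total degree k. *)
Definition kriz_bideg (q k : nat) : kriz -> Prop := lspan (kriz_monomial q k).

Record homogeneous_basis := HomogeneousBasis {
  hb_size : nat;
  hb_elt : hb_size.+1.-tuple H;
  hb_deg : 'I_hb_size.+1 -> nat;
  hb_basis : basis_of fullv hb_elt;
  hb_homog : forall k, tnth hb_elt k \in coh H (hb_deg k);
  hb_mono : forall k l : 'I_hb_size.+1, (k <= l)%N -> (hb_deg k <= hb_deg l)%N;
  hb_one : tnth hb_elt ord0 = 1;
  hb_top : hb_deg ord_max = m.*2
}.

Variable B : homogeneous_basis.
Local Notation idx := 'I_(hb_size B).+1.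
Local Notation x_ := (tnth (hb_elt B)).

Definition fund_class : H := x_ ord_max.

(* \int_X, normalised by \int_X w = 1: no other x_k has degree 2m. *)
Definition coh_int (x : H) : rat := coord (hb_elt B) ord_max x.

Definition coh_pairing : 'M[rat]_((hb_size B).+1) :=
  \matrix_(k, l) coh_int (x_ k * x_ l).

(* The Poincare dual basis: \int_X x_k * dual_basis l = (k == l). *)
Definition dual_basis (k : idx) : H := \sum_l invmx coh_pairing l k *: x_ l.

(* p_ij^* Delta, where the class of the diagonal
     Delta = \sum_k (-1)^(deg x_k) x_k \otimes dual_basis k
   is the class with \int_(X^2) (a \otimes b) Delta = \int_X a b. *)
Definition kriz_diag (i j : 'I_n) : kriz :=
  \sum_k (-1) ^+ hb_deg k * (kriz_p i (x_ k) * kriz_p j (dual_basis k)).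

(* These conditions determine d, E being generated by E_0 and the G_ij. *)
Record kriz_differential (d : kriz -> kriz) : Prop := {
  kriz_d_E0 : forall k x, kriz_bideg 0 k x -> d x = 0;
  kriz_d_G : forall i j, i != j -> d (kriz_G i j) = kriz_diag i j;
  kriz_d_leibniz : forall q k x y, kriz_bideg q k x ->
    d (x * y) = d x * y + (-1) ^+ k * (x * d y)
}.

Record kriz_action (act : 'S_n -> kriz -> kriz) : Prop := {
  kriz_act_p : forall s i x, act s (kriz_p i x) = kriz_p (s i) x;
  kriz_act_G : forall s i j, act s (kriz_G i j) = kriz_G (s i) (s j)
}.

(* p^*(beta) for the complement of A; [enum] lists it in increasing order. *)
Definition kriz_pbeta (A : {set 'I_n}) (beta : seq idx) : kriz :=
  \prod_(z <- zip (enum (~: A)) beta) kriz_p z.1 (x_ z.2).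

Definition kriz_top_generator (A : {set 'I_n}) (beta : seq idx) (q : nat)
    (g : kriz) : Prop :=
  exists I J : q.-tuple 'I_n,
    [/\ sorted ltn [seq val j | j <- J],
        forall a, (tnth I a < tnth J a)%N,
        {subset I <= A}, {subset J <= A} &
        g = \prod_(i in A :\: [set j in J]) kriz_p i fund_class
            * kriz_pbeta A beta
            * \prod_(a < q) kriz_G (tnth I a) (tnth J a)].

Definition kriz_topAq (A : {set 'I_n}) (beta : seq idx) (q : nat) : kriz -> Prop :=
  lspan (kriz_top_generator A beta q).

(* Below, a sum of subspaces is the span of their union. *)
Definition kriz_topA (A : {set 'I_n}) (beta : seq idx) : kriz -> Prop :=
  lspan (fun x => exists2 q, (q < #|A|)%N & kriz_topAq A beta q x).

Definition kriz_top (a : nat) (beta : seq idx) : kriz -> Prop :=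
  lspan (fun x => exists (A : {set 'I_n}) beta',
    [/\ #|A| = a, perm_eq beta' beta & kriz_topA A beta' x]).

Definition kriz_w : kriz -> Prop :=
  lspan (fun x => exists a beta,
    [/\ (2 <= a <= n)%N, size beta = (n - a)%N, ord_max \notin beta
      & kriz_top a beta x]).

Record subcomplex (d : kriz -> kriz) (V : kriz -> Prop) : Prop := {
  subcomplex_0 : V 0;
  subcomplex_lin : forall (a : rat) x y, V x -> V y -> V (a *: x + y);
  subcomplex_graded : forall x, V x ->
    lspan (fun y => V y /\ exists q k, kriz_bideg q k y) x;
  subcomplex_d : forall x, V x -> V (d x)
}.

Definition acyclic (d : kriz -> kriz) (V : kriz -> Prop) : Prop :=
  forall x, V x -> d x = 0 -> exists2 y, V y & d y = x.

Definition invariant_under (act : 'S_n -> kriz -> kriz) (V : kriz -> Prop) :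
  Prop := forall s x, V x -> V (act s x).

End KrizModel.

(* Main.v *)
(** Multiplication by [w] kills positive degrees, so the differential of a
    generator replaces, one at a time, a factor [G_ij] by [p_j^* w]: forgetting
    the factors [w], E^Top(A, beta) is the Orlik-Solomon algebra of the braid
    arrangement on [A] with [d G_ij = 1].  Let [u < v] be the two smallest
    elements of [A].  Up to sign every generator is [W_y = p_v^* w y] or
    [F_y = G_uv y] for a monomial [y] with no factor at the vertex [v], and
      [d W_y = sum_t D_yt W_t],  [d F_y = W_y - sum_t D_yt F_t]
    with the same matrix [D].  If the generators are linearly independent, a
    cycle [sum a_y W_y + b_y F_y] is therefore the boundary of [sum a_y F_y].

    Independence: E(n+1) should be the free right E(n)-module on the
    [p_{n+1}^* x_k] and the [G_{i,n+1}].  Writing down the matrices of left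
    multiplication and checking the defining relations gives a ring morphism
    from E(n+1) to matrices over E(n), whose first column reads off the factor
    of a monomial at the last vertex; induct on n.

    Invariance: it suffices to treat adjacent transpositions [(k k+1)].  They
    preserve the normal form [i < j] of the generators, except in the presence
    of [G_{k,k+1}], where [p_{k+1}^* w G_{k,k+1} = p_k^* w G_{k,k+1}] or a single
    Arnold relation restores it. *)

Require Import Defs.
From HB Require Import structures.
From mathcomp Require Import all_boot all_order all_algebra all_fingroup all_field.
From mathcomp Require Import finmap monalg.

Set Implicit Arguments.
Unset Strict Implicit.
Unset Printing Implicit Defensive.

Import GRing.Theory.
Local Open Scope ring_scope.

(** * Poincare duality in a homogeneous basis *)

Section Cohomology.
Variables (m : nat) (H : cohomology_ring m) (B : homogeneous_basis H).
Local Notation idx := 'I_(hb_size B).+1.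
Local Notation x_ := (tnth (hb_elt B)).
Local Notation co := (coord (hb_elt B)).
Local Notation w := (fund_class B).

Lemma hb_free : free (hb_elt B).
Proof. exact: basis_free (hb_basis B). Qed.

Lemma coord_hb (k l : idx) : co k (x_ l) = (k == l)%:R.
Proof. by rewrite (tnth_nth 0) (coord_free _ _ hb_free) eq_sym. Qed.

Lemma hb_coord (x : H) : x = \sum_k co k x *: x_ k.
Proof.
rewrite {1}(coord_basis (hb_basis B) (memvf x)).
by apply: eq_bigr => k _; rewrite (tnth_nth 0).
Qed.

Lemma hb_ext (x y : H) : (forall k, co k x = co k y) -> x = y.
Proof. by move=> e; rewrite [x]hb_coord [y]hb_coord; apply: eq_bigr => k _; rewrite e. Qed.

Lemma hb_neq0 (k : idx) : x_ k != 0.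
Proof.
by apply/eqP => xk0; have := coord_hb k k; rewrite xk0 linear0 eqxx => /eqP.
Qed.

Lemma hb_deg_le (k : idx) : (hb_deg k <= m.*2)%N.
Proof.
rewrite leqNgt; apply/negP => /(coh_gt H) h0.
by have := hb_homog k; rewrite h0 memv0 (negPf (hb_neq0 k)).
Qed.

(** Grouping the basis expansion of [x] by degree gives a homogeneous decomposition. By directness
    of the grading it is the one with [x] alone in degree [j]. *)
Lemma coord_homog j (x : H) (k : idx) : x \in coh H j -> hb_deg k != j -> co k x = 0.
Proof.
move=> xj kj.
have [ltj|gtj] := ltnP j m.*2.+1; last first.
  by move: xj; rewrite coh_gt // memv0 => /eqP->; rewrite linear0.
pose y (i : 'I_m.*2.+1) := \sum_(l | hb_deg l == i) co l x *: x_ l.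
pose z (i : 'I_m.*2.+1) := if i == j :> nat then x else 0.
have yi i : true -> y i \in coh H i.
  by move=> _; apply: memv_suml => l /eqP<-; rewrite memvZ ?hb_homog.
have zi i : true -> z i \in coh H i.
  by rewrite /z; case: eqP => [->|]; rewrite ?mem0v.
have := @directv_sum_unique _ _ _ _ _ (coh_direct H) y z yi zi.
have -> : \sum_i y i = x.
  rewrite [RHS]hb_coord (partition_big (fun l : idx => (inord (hb_deg l) : 'I_m.*2.+1))
    xpredT) //=.
  apply: eq_bigr => i _; apply: eq_bigl => l.
  by rewrite -val_eqE /= inordK // ltnS hb_deg_le.
have -> : \sum_i z i = x.
  rewrite (bigD1 (Ordinal ltj)) //= {1}/z eqxx big1 ?addr0 // => i.
  by rewrite -val_eqE /z /= => /negPf->.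
rewrite eqxx => /esym/forall_inP/(_ (Ordinal (hb_deg_le k : hb_deg k < m.*2.+1)%N) isT)/eqP.
rewrite /y /z /= (negPf kj) => /(congr1 (co k)).
rewrite linear0 linear_sum (bigD1 k) //= linearZ /= coord_hb eqxx mulr1.
rewrite big1 ?addr0 // => l /andP[_ lk].
by rewrite linearZ /= coord_hb eq_sym (negPf lk) mulr0.
Qed.

(** By [coh_top] the part of degree $2m$ is the line through [w], and distinct members of a basis
    are not proportional. *)
Lemma hb_deg_top (k : idx) : hb_deg k = m.*2 -> k = ord_max.
Proof.
move=> dk; have wt : w \in coh H m.*2 by rewrite -(hb_top B) hb_homog.
have /vlineP[c xk] : x_ k \in <[w]>%VS.
  have /eqP-> : (<[w]> == coh H m.*2)%VS.
    by rewrite eqEdim -memvE wt coh_top dim_vline hb_neq0.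
  by rewrite -dk hb_homog.
have := coord_hb k k; rewrite xk eqxx linearZ /= coord_hb.
by case: eqP => // _ /eqP; rewrite mulr0.
Qed.

Lemma hb_deg_bot (k : idx) : hb_deg k = 0%N -> k = ord0.
Proof.
move=> dk; have := hb_homog k; rewrite dk coh_conn => /vlineP[c xk].
have := coord_hb k k; rewrite xk -(hb_one B) eqxx linearZ /= coord_hb.
by case: eqP => // _ /eqP; rewrite mulr0.
Qed.

Lemma hb_deg0 : hb_deg (ord0 : idx) = 0%N.
Proof.
apply/eqP/negPn/negP => d0; have o1 : (1 : H) \in coh H 0 by rewrite coh_conn memv_line.
have := coord_homog o1 d0; rewrite -(hb_one B) coord_hb eqxx.
by move/eqP; rewrite oner_eq0.
Qed.

Lemma fund_class_coh : w \in coh H m.*2.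
Proof. by rewrite -(hb_top B) hb_homog. Qed.

Lemma coh_int_homog j (x : H) : x \in coh H j -> j != m.*2 -> coh_int B x = 0.
Proof. by move=> xj jt; apply: (coord_homog xj); rewrite hb_top eq_sym. Qed.

Lemma coh_top_int (x : H) : x \in coh H m.*2 -> x = coh_int B x *: w.
Proof.
move=> xt; apply: hb_ext => k; rewrite linearZ /= coord_hb /coh_int.
case: eqP => [->|kt]; first by rewrite mulr1.
by rewrite mulr0 (coord_homog xt) //; apply/eqP => /hb_deg_top.
Qed.

Lemma fund_class_mul k (x : H) : x \in coh H k -> (0 < k)%N -> x * w = 0.
Proof.
move=> xk k0; have := subvP (coh_mul H k m.*2) _ (memv_mul xk fund_class_coh).
by rewrite coh_gt ?memv0 => [/eqP//|]; rewrite -[ltnLHS]add0n ltn_add2r.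
Qed.

Lemma coh_mem_mul k l (x y : H) : x \in coh H k -> y \in coh H l -> x * y \in coh H (k + l).
Proof. by move=> xk yl; apply: (subvP (coh_mul H k l)); apply: memv_mul. Qed.

Definition hb_part (j : nat) (x : H) : H := \sum_(k | hb_deg k == j) co k x *: x_ k.

Lemma hb_part_homog j x : hb_part j x \in coh H j.
Proof. by apply: memv_suml => l /eqP<-; rewrite memvZ ?hb_homog. Qed.

Lemma coord_part j x k : co k (hb_part j x) = if hb_deg k == j then co k x else 0.
Proof.
rewrite linear_sum; have [kj|kj] := ifP.
  rewrite (bigD1 k) //= linearZ /= coord_hb eqxx mulr1 big1 ?addr0 // => l /andP[_ lk].
  by rewrite linearZ /= coord_hb eq_sym (negPf lk) mulr0.
rewrite big1 // => l lj; rewrite linearZ /= coord_hb.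
by case: eqP => [e|]; rewrite ?mulr0 //; rewrite e lj in kj.
Qed.

Lemma coh_int_mul_sum (x y : H) : coh_int B (x * y) = \sum_k co k x * coh_int B (x_ k * y).
Proof.
rewrite {1}[x]hb_coord mulr_suml /coh_int linear_sum; apply: eq_bigr => k _.
by rewrite -scalerAl linearZ.
Qed.

Lemma coh_int_part j (x y : H) : (j <= m.*2)%N -> y \in coh H (m.*2 - j) ->
  coh_int B (hb_part j x * y) = coh_int B (x * y).
Proof.
move=> jm yj; rewrite !coh_int_mul_sum; apply: eq_bigr => k _.
rewrite coord_part; case: eqP => // /eqP kj.
rewrite (coh_int_homog (coh_mem_mul (hb_homog k) yj)) ?mulr0 //.
by apply: contra kj => /eqP e; rewrite -(eqn_add2r (m.*2 - j)) e subnKC.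
Qed.

(** The duality axiom speaks of homogeneous classes only. It is applied to one homogeneous part of
    [x]; a test class of complementary degree pairs with [x] as it does with that part. *)
Lemma coh_int_nondeg (x : H) : (forall y, coh_int B (x * y) = 0) -> x = 0.
Proof.
move=> x0; apply: hb_ext => k; rewrite linear0.
have [//|ck] := co k x =P 0.
have px : hb_part (hb_deg k) x != 0.
  apply/eqP => /(congr1 (co k)); rewrite coord_part eqxx linear0; exact: ck.
have [y yl] := coh_duality (subnKC (hb_deg_le k)) (hb_part_homog _ _) px.
have := coh_mem_mul (hb_part_homog (hb_deg k) x) yl.
rewrite subnKC ?hb_deg_le // => /coh_top_int->.
by rewrite coh_int_part ?hb_deg_le // x0 scale0r eqxx.
Qed.

Lemma coh_pairing_unit : coh_pairing B \in unitmx.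
Proof.
rewrite -row_free_unit; apply/row_freeP/row_freeP.
apply/inj_row_free => v v0.
(* A row vector [v] killed by the matrix of the pairing is the coordinate vector of a class that
   pairs to zero with every class. *)
pose x := \sum_k v 0 k *: x_ k.
have cx k : co k x = v 0 k.
  rewrite linear_sum (bigD1 k) //= linearZ /= coord_hb eqxx mulr1 big1 ?addr0 // => l lk.
  by rewrite linearZ /= coord_hb eq_sym (negPf lk) mulr0.
have x0 : x = 0.
  apply: coh_int_nondeg => y;
    rewrite [y]hb_coord mulr_sumr /coh_int linear_sum big1 // => l _.
  rewrite -scalerAr linearZ /=; have /rowP/(_ l) := v0; rewrite !mxE.
  move=> e; rewrite -[X in _ * X]/(coh_int B (x * x_ l)) coh_int_mul_sum.
  rewrite [X in _ * X](_ : _ = 0) ?mulr0 // -[RHS]e.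
  by apply: eq_bigr => k _; rewrite cx !mxE.
by apply/rowP => k; rewrite -cx x0 linear0 mxE.
Qed.

Lemma dual_basisP (k l : idx) : coh_int B (x_ k * dual_basis l) = (k == l)%:R.
Proof.
have := mulmxV coh_pairing_unit => /matrixP/(_ k l); rewrite !mxE => <-.
rewrite /dual_basis mulr_sumr /coh_int linear_sum; apply: eq_bigr => j _.
by rewrite -scalerAr linearZ /= mxE mulrC.
Qed.

Lemma dual_basis_unique (l : idx) (y : H) :
  (forall k, coh_int B (x_ k * y) = (k == l)%:R) -> y = dual_basis l.
Proof.
move=> yl; pose cy (z : H) : 'cV_(hb_size B).+1 := \col_j co j z.
have cyE z k : (coh_pairing B *m cy z) k 0 = coh_int B (x_ k * z).
  rewrite {2}[z]hb_coord mulr_sumr /coh_int linear_sum mxE; apply: eq_bigr => j _.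
  by rewrite -scalerAr linearZ /= !mxE mulrC.
suff /colP e : cy y = cy (dual_basis l) by apply: hb_ext => k; have := e k; rewrite !mxE.
apply: (can_inj (mulKmx coh_pairing_unit)); apply/colP => k.
by rewrite !cyE yl dual_basisP.
Qed.

(** The component in this degree satisfies the equations that characterise [dual_basis l], so it is
    all of [dual_basis l]. *)
Lemma dual_basis_homog (l : idx) : dual_basis l \in coh H (m.*2 - hb_deg l).
Proof.
rewrite -(@dual_basis_unique l (hb_part (m.*2 - hb_deg l)%N (dual_basis l)))
  ?hb_part_homog // => k.
have [kl|/eqP kl] := hb_deg k =P hb_deg l; last first.
  rewrite (coh_int_homog (coh_mem_mul (hb_homog k) (hb_part_homog _ _))).
    by case: eqP => // e; rewrite e eqxx in kl.
  apply: contra kl => /eqP e.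
  by rewrite -(eqn_add2r (m.*2 - hb_deg l)) e subnKC ?hb_deg_le.
rewrite -dual_basisP {2}[dual_basis l]hb_coord mulr_sumr /coh_int !linear_sum /=.
rewrite /hb_part mulr_sumr linear_sum big_mkcond /=; apply: eq_bigr => j _.
case: eqP => // /eqP jl; rewrite -scalerAr linearZ /= -/(coh_int B _).
rewrite (coh_int_homog (coh_mem_mul (hb_homog k) (hb_homog j))) ?mulr0 //.
by apply: contra jl => /eqP <-; rewrite kl addKn.
Qed.

(** Identifies the summand $1\otimes w$ of the diagonal class, the one that survives in
    [diag_saturated]. *)
Lemma dual_basis0 : dual_basis (ord0 : idx) = w.
Proof.
apply/esym/dual_basis_unique => k.
case: eqP => [->|k0].
  by rewrite hb_one mul1r /coh_int coord_hb eqxx.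
rewrite (fund_class_mul (hb_homog k)) ?/coh_int ?linear0 // lt0n.
by apply/eqP => /hb_deg_bot.
Qed.
End Cohomology.

(* Stated over an abstract source: in the concrete kriz_free, failed
   unifications unfold products of malg. *)
Section AbstractEvaluation.
Variables (A : lalgType rat) (R : nzRingType) (c : rat -> R) (ev : A -> R).
Hypothesis evB : forall x y, ev (x - y) = ev x - ev y.
Hypothesis evD : forall x y, ev (x + y) = ev x + ev y.
Hypothesis evM : forall x y, ev (x * y) = ev x * ev y.
Hypothesis ev1 : ev 1 = 1.
Hypothesis evZ : forall a x, ev (a *: x) = c a * ev x.

Lemma ev_lin u v z a u' v' z' : ev u = u' -> ev v = v' -> ev z = z' ->
  ev (u - (a *: v + z)) = u' - (c a * v' + z').
Proof. by move=> <- <- <-; rewrite evB evD evZ. Qed.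
Lemma ev_sub1 u u' : ev u = u' -> ev (u - 1) = u' - 1.
Proof. by move=> <-; rewrite evB ev1. Qed.
Lemma ev_sub u v u' v' : ev u = u' -> ev v = v' -> ev (u - v) = u' - v'.
Proof. by move=> <- <-; rewrite evB. Qed.
Lemma ev_mul u v z u' v' z' : ev u = u' -> ev v = v' -> ev z = z' ->
  ev (u - v * z) = u' - v' * z'.
Proof. by move=> <- <- <-; rewrite evB evM. Qed.
Lemma ev_sign k : ev ((-1) ^+ k) = (-1) ^+ k.
Proof.
have ev0 : ev 0 = 0 by rewrite -(subrr 0) evB subrr.
elim: k => [|k IHk]; first exact: ev1.
by rewrite !exprS evM IHk -sub0r evB ev0 ev1 sub0r.
Qed.
Lemma ev_comm u v k u' v' : ev u = u' -> ev v = v' ->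
  ev (u * v - (-1) ^+ k * (v * u)) = u' * v' - (-1) ^+ k * (v' * u').
Proof. by move=> <- <-; rewrite evB !evM ev_sign. Qed.
Lemma ev_acomm u v u' v' : ev u = u' -> ev v = v' ->
  ev (u * v + v * u) = u' * v' + v' * u'.
Proof. by move=> <- <-; rewrite evD !evM. Qed.
Lemma ev_mulB u v z t u' v' z' t' :
  ev u = u' -> ev v = v' -> ev z = z' -> ev t = t' ->
  ev (u * v - z * t) = u' * v' - z' * t'.
Proof. by move=> <- <- <- <-; rewrite evB !evM. Qed.
Lemma ev_mulBB u v z t x y u' v' z' t' x' y' :
  ev u = u' -> ev v = v' -> ev z = z' -> ev t = t' -> ev x = x' -> ev y = y' ->
  ev (u * v - (z * t - x * y)) = u' * v' - (z' * t' - x' * y').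
Proof. by move=> <- <- <- <- <- <-; rewrite !evB !evM. Qed.

End AbstractEvaluation.

(** * The universal property of the Kriz model *)

Section KrizSystem.
Variables (m : nat) (H : cohomology_ring m).

(** The defining relations in an arbitrary ring, scalars entering through [c]. In this form they can
    be stated for matrices over $E(n)$ without a rational algebra structure on those. *)
Record kriz_system (n : nat) (R : nzRingType) (c : rat -> R)
    (p : 'I_n -> H -> R) (G : 'I_n -> 'I_n -> R) : Prop := KrizSystem {
  ks_central : forall a x, GRing.comm (c a) x;
  ks_lin : forall i a x y, p i (a *: x + y) = c a * p i x + p i y;
  ks_one : forall i, p i 1 = 1;
  ks_mul : forall i x y, p i (x * y) = p i x * p i y;
  ks_pp : forall i j k l x y, x \in coh H k -> y \in coh H l ->
    p i x * p j y = (-1) ^+ (k * l) * (p j y * p i x);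
  ks_pG : forall i j h k x, x \in coh H k ->
    p i x * G j h = (-1) ^+ (k * m.*2.-1) * (G j h * p i x);
  ks_GG : forall i j h l, G i j * G h l = - (G h l * G i j);
  ks_diag : forall i, G i i = 0;
  ks_sym : forall i j, G j i = G i j;
  ks_p_G : forall (i j : 'I_n) x, (i < j)%N -> p j x * G i j = p i x * G i j;
  ks_arnold : forall i j k : 'I_n, (i < j)%N -> (j < k)%N ->
    G i k * G j k = G i j * G j k - G i j * G i k
}.

Section Universal.
Variables (n : nat) (R : nzRingType) (c : {rmorphism rat -> R}).
Variables (p : 'I_n -> H -> R) (G : 'I_n -> 'I_n -> R).
Hypothesis S : kriz_system c p G.

Let l (g : kriz_letter H n) : R :=
  match g with inl (i, x) => p i x | inr (i, j) => G i j end.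

Let h (u : {fmonom kriz_letter H n}) : R := \prod_(g <- (u : seq _)) l g.

Fact eval_letters_morphism : mmorphism h.
Proof.
split=> [u v|]; first by rewrite /h fmM big_cat.
by rewrite /h fm1 big_nil.
Qed.

Let hB := isMultiplicative.Build _ _ h eval_letters_morphism.
Let hh : {mmorphism {fmonom kriz_letter H n} -> R} := HB.pack h hB.
Let ev : kriz_free H n -> R := mmap c hh.

Let evB x y : ev (x - y) = ev x - ev y. Proof. exact: mmapB. Qed.
Let evD x y : ev (x + y) = ev x + ev y. Proof. exact: mmapD. Qed.
Let evM x y : ev (x * y) = ev x * ev y.
Proof.
apply: (commr_mmap_is_multiplicative (f := c) (h := hh) _).1 => g u v.
exact: ks_central S _ _.
Qed.
Let ev1 : ev 1 = 1. Proof. exact: mmap1. Qed.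
Let ev0 : ev 0 = 0. Proof. exact: mmap0. Qed.
Let evZ a x : ev (a *: x) = c a * ev x. Proof. exact: mmapZ. Qed.
Let evp i x : ev (free_p i x) = p i x.
Proof.
apply: etrans (mmapU (f := c) (h := hh) _ _) _.
by rewrite /= rmorph1 mul1r /h fmU big_seq1.
Qed.
Let evG i j : ev (free_G H i j) = G i j.
Proof.
apply: etrans (mmapU (f := c) (h := hh) _ _) _.
by rewrite /= rmorph1 mul1r /h fmU big_seq1.
Qed.

Let ev_rel u : kriz_rel u -> ev u = 0.
Proof.
case=> [i a x y|i|i x y|i j k q x y xk yl|i j g k x xk|i j g q|i|i j|i j x ij
       |i j k ij jk].
- by rewrite (ev_lin evB evD evZ a (evp _ _) (evp _ _) (evp _ _)) (ks_lin S) subrr.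
- by rewrite (ev_sub1 evB ev1 (evp _ _)) (ks_one S) subrr.
- by rewrite (ev_mul evB evM (evp _ _) (evp _ _) (evp _ _)) (ks_mul S) subrr.
- by rewrite (ev_comm evB evM ev1 _ (evp _ _) (evp _ _)) (ks_pp S i j xk yl) subrr.
- by rewrite (ev_comm evB evM ev1 _ (evp _ _) (evG _ _)) (ks_pG S i j g xk) subrr.
- by rewrite (ev_acomm evD evM (evG _ _) (evG _ _)) (ks_GG S) addNr.
- by rewrite evG (ks_diag S).
- by rewrite (ev_sub evB (evG _ _) (evG _ _)) (ks_sym S) subrr.
- rewrite (ev_mulB evB evM (evp _ _) (evG _ _) (evp _ _) (evG _ _)).
  by rewrite (ks_p_G S x ij) subrr.
- rewrite (ev_mulBB evB evM (evG _ _) (evG _ _) (evG _ _) (evG _ _) (evG _ _) (evG _ _)).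
  by rewrite (ks_arnold S ij jk) subrr.
Qed.

Let ev_ideal u : kriz_ideal u -> ev u = 0.
Proof.
elim=> {u} [u|||a u _|a u _].
- exact: ev_rel.
- exact: ev0.
- by move=> u v _ eu _ ev'; apply: etrans (evB _ _) _; rewrite eu ev' subrr.
- by move=> eu; apply: etrans (evM _ _) _; rewrite eu mulr0.
- by move=> eu; apply: etrans (evM _ _) _; rewrite eu mul0r.
Qed.

(** Evaluation of letters is multiplicative on the free algebra because the scalars are central. It
    kills the relations, hence the ideal, so its value at [kriz_repr x] depends only on the
    class. *)
Lemma kriz_universal : exists f : {rmorphism kriz H n -> R},
  [/\ forall i x, f (kriz_p i x) = p i x, forall i j, f (kriz_G H i j) = G i j
    & forall a x, f (a *: x) = c a * f x].
Proof.
pose f (x : kriz H n) := ev (kriz_repr x).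
have fpi u : f (kriz_pi u) = ev u.
  apply/eqP; rewrite -subr_eq0 -evB; apply/eqP/ev_ideal/kriz_pi_eq.
  by rewrite kriz_reprK.
have fB : {morph f : x y / x - y}.
  move=> x y; rewrite -[x]kriz_reprK -[y]kriz_reprK.
  by rewrite -kriz_piB !fpi.
have fM : {morph f : x y / x * y}.
  move=> x y; rewrite -[x]kriz_reprK -[y]kriz_reprK.
  by rewrite -[X in f X]/(kriz_mul _ _) -kriz_piM !fpi.
have f1 : f 1 = 1 by rewrite -[X in f X]/(kriz_one H n) fpi.
have fa := GRing.isZmodMorphism.Build _ _ f fB.
have fm := GRing.isMonoidMorphism.Build _ _ f (conj f1 fM).
exists (HB.pack f fa fm : {rmorphism kriz H n -> R}).
split => [i x|i j|a x] /=; rewrite ?fpi //.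
by rewrite -[x]kriz_reprK -[X in f X]/(kriz_scale _ _) -kriz_piZ !fpi.
Qed.

End Universal.

(** * The relations in the Kriz model itself *)

Section QuotientRelations.
Variable n : nat.
Local Notation pi := (@kriz_pi m H n).
Local Notation K := (kriz H n).
Implicit Types u v z t : kriz_free H n.

Let rel u v : kriz_rel (u - v) -> pi u = pi v.
Proof. by move=> uv; apply/kriz_pi_eq/ideal_rel. Qed.
Let rel0 u : kriz_rel u -> pi u = 0.
Proof.
move=> r; have <- : pi 0 = 0 by rewrite /kriz_pi raddf0.
by apply/kriz_pi_eq; apply: ideal_rel; rewrite subr0.
Qed.
Let piM u v : pi (u * v) = (pi u : K) * (pi v : K). Proof. exact: kriz_piM. Qed.
Let piZ a u : pi (a *: u) = a *: (pi u : K). Proof. exact: kriz_piZ. Qed.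
Let piB u v : pi (u - v) = (pi u : K) - pi v. Proof. exact: kriz_piB. Qed.
Let piD u v : pi (u + v) = (pi u : K) + pi v. Proof. exact: kriz_piD. Qed.
Let pi1 : pi 1 = 1 :> K. Proof. by []. Qed.
Let pis k : pi ((-1) ^+ k) = (-1) ^+ k :> K.
Proof. exact: (ev_sign (A := kriz_free H n) (R := K) piB piM pi1). Qed.

Let rel1 u : kriz_rel (u - 1) -> pi u = 1.
Proof. by move=> /rel->. Qed.
Let rel_comm u v k : kriz_rel (u * v - (-1) ^+ k * (v * u)) ->
  (pi u : K) * pi v = (-1) ^+ k * ((pi v : K) * pi u).
Proof.
move=> /rel e; apply: etrans (esym (piM _ _)) _; apply: etrans e _.
by apply: etrans (piM _ _) _; rewrite pis (piM v u).
Qed.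

Let rel_acomm u v : kriz_rel (u * v + v * u) -> (pi u : K) * pi v = - ((pi v : K) * pi u).
Proof.
move=> r; apply/eqP; rewrite -addr_eq0; apply/eqP.
apply: etrans (esym (ev_acomm (A := kriz_free H n) (R := K) piD piM (erefl (pi u))
  (erefl (pi v)))) _.
exact: rel0.
Qed.

Let rel_mulB u v z t : kriz_rel (u * v - z * t) -> (pi u : K) * pi v = (pi z : K) * pi t.
Proof. by move=> /rel e; apply: etrans (esym (piM _ _)) _; apply: etrans e (piM _ _). Qed.

Let rel_mulBB u v z t u' v' : kriz_rel (u * v - (z * t - u' * v')) ->
  (pi u : K) * pi v = (pi z : K) * pi t - (pi u' : K) * pi v'.
Proof.
move=> /rel e; apply: etrans (esym (piM _ _)) _; apply: etrans e _.
by apply: (ev_mulB (A := kriz_free H n) (R := K) piB piM).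
Qed.

Lemma kriz_is_system :
  kriz_system (in_alg (kriz H n)) (@kriz_p m H n) (@kriz_G m H n).
Proof.
split.
- by move=> a x; rewrite /GRing.comm /= -scalerAl mul1r -scalerAr mulr1.
- move=> i a x y; rewrite /= -scalerAl mul1r.
  apply: etrans (rel (rel_lin i a x y)) _; apply: etrans (piD _ _) _.
  by congr (_ + _); apply: piZ.
- by move=> i; apply: rel1 (rel_one H i).
- by move=> i x y; apply: etrans (rel (rel_mul i x y)) (piM _ _).
- by move=> i j k l x y xk yl; apply: rel_comm (rel_pp i j xk yl).
- by move=> i j h k x xk; apply: rel_comm (rel_pG i j h xk).
- by move=> i j h l; apply: rel_acomm (rel_GG H i j h l).
- by move=> i; apply: rel0 (rel_G_diag H i).
- by move=> i j; apply: rel; apply: rel_G_sym.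
- by move=> i j x ij; apply: rel_mulB (rel_p_G x ij).
- by move=> i j k ij jk; apply: rel_mulBB (rel_arnold H ij jk).
Qed.

End QuotientRelations.

End KrizSystem.

(** * The Kriz relations on E(n) tensor H + E(n)^n *)

Lemma odd_double_pred m : (0 < m)%N -> odd m.*2.-1.
Proof. by case: m => // m _; rewrite doubleS /= odd_double. Qed.

Section Extension.
Variables (m : nat) (hm : (0 < m)%N) (H : cohomology_ring m) (B : homogeneous_basis H).
Local Notation idx := 'I_(hb_size B).+1.
Local Notation x_ := (tnth (hb_elt B)).
Local Notation co := (coord (hb_elt B)).

(* Moving x from the left to the right of an element of degree e replaces it
   by sign_twist e x. *)
Definition sign_twist (e : nat) (x : H) : H :=
  \sum_k ((-1) ^+ (e * hb_deg k) * co k x) *: x_ k.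

Lemma sign_twist_lin e a x y :
  sign_twist e (a *: x + y) = a *: sign_twist e x + sign_twist e y.
Proof.
rewrite /sign_twist scaler_sumr -big_split; apply: eq_bigr => k _ /=.
by rewrite linearP mulrDr scalerDl scalerA mulrCA.
Qed.

Lemma sign_twist_homog e k x : x \in coh H k ->
  sign_twist e x = (-1) ^+ (e * k) *: x.
Proof.
move=> xk; rewrite {2}[x](hb_coord B) scaler_sumr; apply: eq_bigr => l _.
rewrite scalerA; have [->//|/eqP lk] := hb_deg l =P k.
by rewrite (coord_homog xk lk) !mulr0.
Qed.

Lemma sign_twist1 e : sign_twist e 1 = 1.
Proof.
by rewrite (@sign_twist_homog e 0) ?muln0 ?scale1r // coh_conn memv_line.
Qed.

Lemma sign_twistM e x y : sign_twist e (x * y) = sign_twist e x * sign_twist e y.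
Proof.
have twD u v : sign_twist e (u + v) = sign_twist e u + sign_twist e v.
  by rewrite -[u]scale1r sign_twist_lin !scale1r.
have tw0 : sign_twist e 0 = 0 by apply: (addIr (sign_twist e 0)); rewrite -twD !add0r.
have twZ a u : sign_twist e (a *: u) = a *: sign_twist e u.
  by rewrite -[a *: u]addr0 sign_twist_lin tw0 addr0.
rewrite [x](hb_coord B) [y](hb_coord B) mulr_suml !(big_morph _ twD tw0) mulr_suml.
apply: eq_bigr => k _; rewrite !mulr_sumr (big_morph _ twD tw0).
apply: eq_bigr => l _; rewrite -!scalerAl -!scalerAr !twZ -!scalerAl -!scalerAr.
rewrite (sign_twist_homog _ (hb_homog k)) (sign_twist_homog _ (hb_homog l)).
rewrite (sign_twist_homog _ (coh_mem_mul (hb_homog k) (hb_homog l))).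
by congr (_ *: (_ *: _)); rewrite -scalerAl -scalerAr scalerA mulnDr exprD.
Qed.

Variables (n : nat) (R : nzRingType) (c : {rmorphism rat -> R}).
Variables (p : 'I_n -> H -> R) (G : 'I_n -> 'I_n -> R).
Hypothesis S : kriz_system c p G.

Lemma ks_sign_exp k : (-1) ^+ (k * m.*2.-1) = (-1) ^+ k :> R.
Proof. by rewrite -signr_odd oddM odd_double_pred // andbT signr_odd. Qed.

Lemma ks_pG_odd i j h k x : x \in coh H k ->
  p i x * G j h = (-1) ^+ k * (G j h * p i x).
Proof. by move=> xk; rewrite (ks_pG S i j h xk) ks_sign_exp. Qed.

Lemma ks_half (x : R) : x = - x -> x = 0.
Proof.
move=> xN; have : c 2^-1 * (x + x) = x.
  rewrite mulrDr -mulrDl -rmorphD (_ : 2^-1 + 2^-1 = 1 :> rat) ?rmorph1 ?mul1r //.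
by rewrite {2}xN subrr mulr0.
Qed.

Lemma ks_G2 i j : G i j * G i j = 0.
Proof. by apply: ks_half; apply: ks_GG S _ _ _ _. Qed.

Lemma ks_p_G_all i j x : p j x * G i j = p i x * G i j.
Proof.
case: (ltngtP i j) => [ij|ji|/val_inj->//]; first exact: ks_p_G S _ _ _ ij.
by rewrite -(ks_sym S i j) (ks_p_G S x ji).
Qed.

Definition arnold i j k := G i j * G j k - G i j * G i k - G i k * G j k.

Lemma arnold_swap12 i j k : arnold j i k = - arnold i j k.
Proof.
rewrite /arnold (ks_GG S j k i k) (ks_sym S i j).
by rewrite opprK !opprB addrC.
Qed.

Lemma arnold_swap23 i j k : arnold i k j = - arnold i j k.
Proof.
rewrite /arnold (ks_sym S j k) (ks_GG S i k i j).
by rewrite opprK !opprB addrA.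
Qed.

(** The expression is antisymmetric in its three indices, so increasing triples settle all distinct
    ones. If two indices coincide it vanishes because $G_{ii}=0$ and $G_{ij}^2=0$. *)
Lemma ks_arnold_all i j k : arnold i j k = 0.
Proof.
have sorted_case (a b e : 'I_n) : (a < b)%N -> (b < e)%N -> arnold a b e = 0.
  by move=> ab be; rewrite /arnold (ks_arnold S ab be) subrr.
have h (a b e : 'I_n) : (a < b)%N -> arnold a b e = 0.
  move=> ab; case: (ltngtP b e) => [be|eb|/val_inj<-]; first exact: sorted_case.
    rewrite -[LHS]opprK -arnold_swap23.
    case: (ltngtP a e) => [ae|ea|/val_inj<-].
    - by rewrite sorted_case ?oppr0.
    - by rewrite -[arnold _ _ _]opprK -arnold_swap12 sorted_case ?oppr0.
    by rewrite /arnold (ks_diag S) !mul0r ks_G2 !subr0 oppr0.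
  by rewrite /arnold (ks_diag S) ks_G2 !mulr0 !subr0.
case: (ltngtP i j) => [ij|ji|/val_inj<-]; first exact: h.
  by rewrite -[LHS]opprK -arnold_swap12 h ?oppr0.
by rewrite /arnold (ks_diag S) ks_G2 !mul0r !subr0.
Qed.

Local Notation b := (hb_size B).+1.
Local Notation ks_ext_mx := 'M[R]_((hb_size B + n).+1).

(** Left multiplication maps the span of the $G_{i,n+1}$ to itself, whence the zero block. The size
    of [ks_ext_mx] is a visible successor, as the ring structure on matrices requires, and converts
    to [b + n]. *)
Definition low_mx (T : 'M[R]_b) (C : 'M[R]_(n, b))
  (D : 'M[R]_n) : ks_ext_mx := block_mx T 0 C D.

Lemma low_mxM T C D T' C' D' :
  low_mx T C D * low_mx T' C' D' =
  low_mx (T *m T') (C *m T' + D *m C') (D *m D').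
Proof.
rewrite /low_mx; apply: etrans (@mulmx_block R b n b n b n _ _ _ _ _ _ _ _) _.
by rewrite !mul0mx !mulmx0 !addr0 add0r.
Qed.

Lemma low_mxD T C D T' C' D' :
  low_mx T C D + low_mx T' C' D' = low_mx (T + T') (C + C') (D + D').
Proof. by apply: etrans (@add_block_mx R b n b n _ _ _ _ _ _ _ _) _; rewrite addr0. Qed.

Lemma low_mxN T C D : - low_mx T C D = low_mx (- T) (- C) (- D).
Proof. by apply: etrans (@opp_block_mx R b n b n _ _ _ _) _; rewrite oppr0. Qed.

Lemma low_mxZ a T C D :
  (a%:M : ks_ext_mx) * low_mx T C D = low_mx (a *: T) (a *: C) (a *: D).
Proof.
rewrite -mulmxE mul_scalar_mx.
by apply: etrans (@scale_block_mx R b n b n _ _ _ _ _) _; rewrite scaler0.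
Qed.

Lemma low_mx_sign k T C D :
  (-1) ^+ k * low_mx T C D =
  low_mx ((-1) ^+ k *: T) ((-1) ^+ k *: C) ((-1) ^+ k *: D).
Proof. by rewrite -low_mxZ rmorphXn rmorphN1. Qed.

Lemma low_mx1 : low_mx 1%:M 0 1%:M = 1.
Proof. by rewrite /low_mx -scalar_mx_block. Qed.

(* Below, a column (f_k, f_i) stands for
   sum_k p_{n+1}^* x_k f_k + sum_i G_{i,n+1} f_i, on which the generators of
   E(n+1) act by left multiplication; old and new refer to the vertices < n and
   to the last one. *)
Definition ext_p_old i x : ks_ext_mx :=
  low_mx (diag_mx (\row_k p i (sign_twist (hb_deg k) x))) 0
    (diag_mx (\row_(_ < n) p i (sign_twist 1 x))).

(** The lower block comes from $p_{n+1}^*x\,G_{i,n+1}=p_i^*x\,G_{i,n+1}$; moving $p_i^*x$ to the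
    right of the odd element $G_{i,n+1}$ applies [sign_twist 1]. *)
Definition ext_p_new x : ks_ext_mx :=
  low_mx (\matrix_(l, k) c (co l (x * x_ k))) 0
    (diag_mx (\row_i p i (sign_twist 1 x))).

Definition ext_G_old i j : ks_ext_mx :=
  low_mx (diag_mx (\row_k ((-1) ^+ hb_deg k * G i j))) 0 (diag_mx (\row_(_ < n) - G i j)).

(** The left columns express $G_{i,n+1}\,p_{n+1}^*x_k=G_{i,n+1}\,p_i^*x_k$. The right ones are the
    Arnold relation with coefficients on the right:
    $G_{i,n+1}G_{q,n+1}=G_{i,n+1}G_{iq}-G_{q,n+1}G_{iq}$. *)
Definition ext_G_new i : ks_ext_mx :=
  low_mx 0 (\matrix_(r, k) (p i (x_ k) *+ (r == i)))
    (\matrix_(r, q) (G i q *+ (r == i) - G i q *+ (r == q))).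

Definition ext_p (j : 'I_n.+1) x : ks_ext_mx :=
  if unlift ord_max j is Some i then ext_p_old i x else ext_p_new x.

Definition ext_G (j h : 'I_n.+1) : ks_ext_mx :=
  match unlift ord_max j, unlift ord_max h with
  | Some i, Some k => ext_G_old i k
  | Some i, None | None, Some i => ext_G_new i
  | None, None => 0
  end.

Definition ext_c : {rmorphism rat -> ks_ext_mx} :=
  [the {rmorphism rat -> ks_ext_mx} of (@scalar_mx R (hb_size B + n).+1) \o c].

Lemma ks_C a x : c a * x = x * c a.
Proof. exact: ks_central S a x. Qed.

Lemma ks_p0 i : p i 0 = 0.
Proof.
by apply: (addIr (p i 0)); rewrite -{1}[p i 0]mul1r -(rmorph1 c) -(ks_lin S) scaler0 !add0r.
Qed.

Lemma ks_pZ i a x : p i (a *: x) = c a * p i x.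
Proof. by rewrite -[a *: x]addr0 (ks_lin S) ks_p0 addr0. Qed.

Lemma ks_pD i x y : p i (x + y) = p i x + p i y.
Proof. by rewrite -[x]scale1r (ks_lin S) rmorph1 scale1r mul1r. Qed.

Lemma ks_p_coord i x : p i x = \sum_k p i (x_ k) * c (co k x).
Proof.
rewrite {1}[x](hb_coord B) (big_morph _ (ks_pD i) (ks_p0 i)).
by apply: eq_bigr => k _; rewrite ks_pZ ks_C.
Qed.

Lemma sign_twist_mem e k x : x \in coh H k -> sign_twist e x \in coh H k.
Proof. by move=> xk; rewrite (sign_twist_homog _ xk) memvZ. Qed.

Lemma ks_p_twist i e k x : x \in coh H k -> p i (sign_twist e x) = (-1) ^+ (e * k) * p i x.
Proof. by move=> xk; rewrite (sign_twist_homog _ xk) ks_pZ rmorph_sign. Qed.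

Lemma ks_pp_twist i j l x y : y \in coh H l -> p i x * p j y = p j y * p i (sign_twist l x).
Proof.
move=> yl; rewrite [x](hb_coord B) /sign_twist.
rewrite !(big_morph _ (ks_pD i) (ks_p0 i)) mulr_suml mulr_sumr.
apply: eq_bigr => k _; rewrite -(hb_coord B) !ks_pZ.
rewrite [RHS]mulrA -ks_C -mulrA (ks_pp S i j (hb_homog k) yl) rmorphM rmorph_sign /=.
by rewrite [LHS]mulrA -[RHS]mulrA ks_C mulnC.
Qed.

Lemma ks_Gp_all i j k x : x \in coh H k -> G i j * p j x = G i j * p i x.
Proof.
move=> xk; have e h : G i j * p h x = (-1) ^+ k * (p h x * G i j).
  by rewrite (ks_pG_odd _ _ _ xk) signrMK.
by rewrite !e ks_p_G_all.
Qed.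

Lemma G_new_mulE i q (A : 'M[R]_(n, q)) r k :
  ((\matrix_(r, q) (G i q *+ (r == i) - G i q *+ (r == q)) : 'M[R]_n) *m A) r k =
  (\sum_l G i l * A l k) *+ (r == i) - G i r * A r k.
Proof.
rewrite mxE; under eq_bigr => l _ do rewrite mxE mulrBl mulrnAl.
rewrite big_split /= -sumrMnl; congr (_ + _).
rewrite (bigD1 r) //= eqxx mulr1n big1 ?addr0 // => l lr.
by rewrite eq_sym (negPf lr) mul0r oppr0.
Qed.

(** * Verification of the defining relations for the matrices *)

Lemma ext_p_old_lin i a x y :
  ext_p_old i (a *: x + y) = ext_c a * ext_p_old i x + ext_p_old i y.
Proof.
rewrite /ext_p_old low_mxZ low_mxD; congr low_mx; last 1 first.
- apply/matrixP => r q; rewrite !mxE sign_twist_lin (ks_lin S).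
  by case: eqP; rewrite ?mulr1n // !mulr0n mulr0 addr0.
- apply/matrixP => r q; rewrite !mxE sign_twist_lin (ks_lin S).
  by case: eqP; rewrite ?mulr1n // !mulr0n mulr0 addr0.
by rewrite scaler0 addr0.
Qed.

Lemma ext_p_new_lin a x y :
  ext_p_new (a *: x + y) = ext_c a * ext_p_new x + ext_p_new y.
Proof.
rewrite /ext_p_new low_mxZ low_mxD; congr low_mx; last 1 first.
- apply/matrixP => r q; rewrite !mxE sign_twist_lin (ks_lin S).
  by case: eqP; rewrite ?mulr1n // !mulr0n mulr0 addr0.
- by apply/matrixP => r q; rewrite !mxE mulrDl -scalerAl linearP rmorphD rmorphM.
by rewrite scaler0 addr0.
Qed.

Lemma ext_p_old1 i : ext_p_old i 1 = 1.
Proof.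
rewrite /ext_p_old -low_mx1; congr low_mx; apply/matrixP => r q;
by rewrite !mxE sign_twist1 (ks_one S).
Qed.

Lemma ext_p_new1 : ext_p_new 1 = 1.
Proof.
rewrite /ext_p_new -low_mx1; congr low_mx; apply/matrixP => r q; rewrite !mxE.
  by rewrite mul1r coord_hb rmorph_nat.
by rewrite sign_twist1 (ks_one S).
Qed.

Lemma ext_p_oldM i x y : ext_p_old i (x * y) = ext_p_old i x * ext_p_old i y.
Proof.
rewrite /ext_p_old low_mxM !mul0mx !mulmx0 addr0.
by congr low_mx; apply/matrixP => r q;
  rewrite ?mul_diag_mx ?mul_mx_diag !mxE sign_twistM (ks_mul S) mulrnAr.
Qed.

Lemma ext_p_newM x y : ext_p_new (x * y) = ext_p_new x * ext_p_new y.
Proof.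
rewrite /ext_p_new low_mxM !mul0mx !mulmx0 addr0.
congr low_mx; apply/matrixP => r q;
  rewrite ?mul_diag_mx ?mul_mx_diag !mxE ?sign_twistM ?(ks_mul S) ?mulrnAr //.
rewrite -mulrA [y * _](hb_coord B) mulr_sumr linear_sum rmorph_sum.
apply: eq_bigr => k _; rewrite !mxE -?(hb_coord B) -scalerAr linearZ rmorphM /=.
exact: ks_C.
Qed.


Lemma signCA e (x y : R) : x * ((-1) ^+ e * y) = (-1) ^+ e * (x * y).
Proof. by rewrite mulrA commr_sign mulrA. Qed.

Lemma signMM e (x y : R) : ((-1) ^+ e * x) * ((-1) ^+ e * y) = x * y.
Proof. by rewrite -mulrA signCA signrMK. Qed.

(** A nonzero entry of the matrix of [x] determines the degree attached to its row, and with it the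
    sign to be compared there. *)
Lemma mul_coord_deg k x (l q : idx) : x \in coh H k -> co l (x * x_ q) != 0 ->
  hb_deg l = (k + hb_deg q)%N.
Proof.
move=> xk; case: (hb_deg l =P (k + hb_deg q)%N) => // /eqP dl.
by rewrite (coord_homog (coh_mem_mul xk (hb_homog q)) dl) eqxx.
Qed.

Lemma ext_p_old_old i j k l x y : x \in coh H k -> y \in coh H l ->
  ext_p_old i x * ext_p_old j y = (-1) ^+ (k * l) * (ext_p_old j y * ext_p_old i x).
Proof.
move=> xk yl; rewrite /ext_p_old !low_mxM low_mx_sign !mul0mx !mulmx0 addr0 scaler0.
congr low_mx; apply/matrixP => r q; rewrite ?mul_diag_mx !mxE;
by rewrite !mulrnAr (ks_pp S i j (sign_twist_mem _ xk) (sign_twist_mem _ yl)).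
Qed.

Lemma ext_p_newZ a x : ext_p_new (a *: x) = ext_c a * ext_p_new x.
Proof.
have e0 : ext_p_new 0 = 0.
  by apply: (addIr (ext_p_new 0));
    rewrite -{1}[ext_p_new 0]mul1r -(rmorph1 ext_c) -ext_p_new_lin scaler0 !add0r.
by rewrite -[a *: x]addr0 ext_p_new_lin e0 addr0.
Qed.

Lemma ext_p_new_new k l x y : x \in coh H k -> y \in coh H l ->
  ext_p_new x * ext_p_new y = (-1) ^+ (k * l) * (ext_p_new y * ext_p_new x).
Proof.
move=> xk yl; rewrite -!ext_p_newM (coh_comm xk yl).
have -> : (-1) ^+ (k * l) * (y * x) = ((-1) ^+ (k * l)) *: (y * x).
  by rewrite -!(signr_odd _ (k * l)); case: odd; rewrite ?scaleN1r ?mulN1r ?scale1r ?mul1r.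
by rewrite ext_p_newZ rmorph_sign.
Qed.

Lemma ext_p_old_new i k l x y : x \in coh H k -> y \in coh H l ->
  ext_p_old i x * ext_p_new y = (-1) ^+ (k * l) * (ext_p_new y * ext_p_old i x).
Proof.
move=> xk yl; rewrite /ext_p_old /ext_p_new !low_mxM low_mx_sign !mul0mx !mulmx0 addr0
  scaler0.
congr low_mx; apply/matrixP => r q; rewrite ?mul_diag_mx ?mul_mx_diag !mxE.
  have [->|/(mul_coord_deg yl) dr] := eqVneq (co r (y * x_ q)) 0.
    by rewrite rmorph0 mulr0 mul0r mulr0.
  by rewrite dr !(ks_p_twist _ _ xk) mulnDl exprD [in RHS]ks_C !mulrA [(l * k)%N]mulnC.
by rewrite !mulrnAr (ks_pp S i _ (sign_twist_mem _ xk) (sign_twist_mem _ yl)).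
Qed.

Lemma ext_pG_old_old i j h k x : x \in coh H k ->
  ext_p_old i x * ext_G_old j h = (-1) ^+ (k * m.*2.-1) * (ext_G_old j h * ext_p_old i x).
Proof.
move=> xk; rewrite /ext_p_old /ext_G_old !low_mxM low_mx_sign !mul0mx !mulmx0 addr0 scaler0.
congr low_mx; apply/matrixP => r q; rewrite ?mul_diag_mx !mxE !mulrnAr.
  by rewrite mulrA commr_sign -!mulrA (ks_pG S i j h (sign_twist_mem _ xk)) !mulrA
    commr_sign.
by rewrite mulrN mulNr mulrN (ks_pG S i j h (sign_twist_mem _ xk)).
Qed.

Lemma ext_pG_new_old j h k x : x \in coh H k ->
  ext_p_new x * ext_G_old j h = (-1) ^+ (k * m.*2.-1) * (ext_G_old j h * ext_p_new x).
Proof.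
move=> xk; rewrite /ext_p_new /ext_G_old !low_mxM low_mx_sign !mul0mx !mulmx0 addr0 scaler0.
congr low_mx; apply/matrixP => r q; rewrite ?mul_diag_mx ?mul_mx_diag !mxE; last first.
  by rewrite !mulrnAr mulrN mulNr mulrN (ks_pG S _ j h (sign_twist_mem _ xk)).
have [->|/(mul_coord_deg xk) dr] := eqVneq (co r (x * x_ q)) 0.
  by rewrite rmorph0 mul0r !mulr0.
by rewrite dr ks_sign_exp exprD [LHS]ks_C !mulrA -expr2 -exprM mulnC exprM sqrrN expr1n
  expr1n mul1r.
Qed.

Lemma ext_pG_old_new i j k x : x \in coh H k ->
  ext_p_old i x * ext_G_new j = (-1) ^+ (k * m.*2.-1) * (ext_G_new j * ext_p_old i x).
Proof.
move=> xk; rewrite /ext_p_old /ext_G_new !low_mxM low_mx_sign !mul0mx !mulmx0 addr0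
  add0r scaler0.
congr low_mx; apply/matrixP => r q; rewrite ?mul_diag_mx ?mul_mx_diag !mxE.
  rewrite ?addr0 mulrnAr mulrnAl mulrnAr (ks_pp_twist i j _ (hb_homog q)).
  rewrite ks_sign_exp !(ks_p_twist _ _ (sign_twist_mem _ xk)) !(ks_p_twist _ _ xk).
  by rewrite mul1n ![p j _ * (_ * _)]signCA; congr (_ *+ _); apply: signCA.
rewrite mulrBr mulrBl mulrBr !mulrnAr !mulrnAl !mulrnAr.
by rewrite (ks_pG S i j q (sign_twist_mem _ xk)).
Qed.

Lemma ext_pG_new_new j k x : x \in coh H k ->
  ext_p_new x * ext_G_new j = (-1) ^+ (k * m.*2.-1) * (ext_G_new j * ext_p_new x).
Proof.
move=> xk; rewrite /ext_p_new /ext_G_new !low_mxM low_mx_sign !mul0mx !mulmx0 addr0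
  add0r scaler0.
congr low_mx; apply/matrixP => r q; rewrite ?mul_diag_mx ?mul_mx_diag !mxE.
  rewrite ?addr0 mulrnAr.
  under eq_bigr => l _ do rewrite !mxE mulrnAl.
  rewrite sumrMnl -ks_p_coord mulrnAr ks_sign_exp (ks_p_twist _ _ xk) mul1n -mulrA.
  by case: (r =P j) => [->|_]; rewrite ?mulr0n // (ks_mul S).
rewrite mulrBr mulrBl mulrBr !mulrnAr !mulrnAl !mulrnAr -(ks_pG S q j q (sign_twist_mem
  _ xk)).
rewrite (ks_p_G_all j q); congr (_ - _); first by case: eqP => [->|]; rewrite ?mulr0n.
by case: eqP => [->|]; rewrite ?mulr0n // ks_p_G_all.
Qed.

Lemma ext_GG_old_old i j h l :
  ext_G_old i j * ext_G_old h l = - (ext_G_old h l * ext_G_old i j).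
Proof.
rewrite /ext_G_old !low_mxM low_mxN !mul0mx !mulmx0 addr0 oppr0.
congr low_mx; apply/matrixP => r q; rewrite ?mul_diag_mx !mxE !mulrnAr -mulNrn;
  congr (_ *+ _).
  by rewrite !signMM (ks_GG S i j h l).
by rewrite !mulrNN (ks_GG S i j h l).
Qed.

Lemma ext_GG_old_new j h i :
  ext_G_old j h * ext_G_new i = - (ext_G_new i * ext_G_old j h).
Proof.
rewrite /ext_G_old /ext_G_new !low_mxM low_mxN !mul0mx !mulmx0 addr0 add0r oppr0.
congr low_mx; apply/matrixP => r q; rewrite ?mul_diag_mx ?mul_mx_diag !mxE.
  rewrite ?addr0 mulrnAr mulrnAl mulNr -mulNrn; congr (_ *+ _); congr (- _).
  by rewrite mulrA commr_sign -mulrA (ks_pG_odd i j h (hb_homog q)) signrMK.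
rewrite mulrN opprK mulrBr mulrBl !mulrnAr !mulrnAl (ks_GG S i q j h).
by rewrite !mulNr.
Qed.

Lemma G_newC i j r q :
  ((\matrix_(r, q) (G i q *+ (r == i) - G i q *+ (r == q)) : 'M[R]_n) *m
   (\matrix_(r, k) (p j (x_ k) *+ (r == j)) : 'M[R]_(n, b))) r q =
  (G i j * p j (x_ q)) *+ (r == i) - (G i j * p j (x_ q)) *+ (r == j).
Proof.
rewrite G_new_mulE (bigD1 j) //= mxE eqxx mulr1n big1 ?addr0 => [|l /negPf lj].
  by rewrite mxE mulrnAr; case: (r =P j) => [->|].
by rewrite mxE lj mulr0.
Qed.

(** The sum contributing to row [i] is $G_{ij}G_{jq}-G_{iq}G_{jq}$, which an Arnold relation of
    $E(n)$ turns into $G_{ij}G_{iq}$. In the resulting form, exchanging [i] and [j] visibly changes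
    the sign. *)
Lemma G_newD i j r q :
  ((\matrix_(r, q) (G i q *+ (r == i) - G i q *+ (r == q)) : 'M[R]_n) *m
   (\matrix_(r, q) (G j q *+ (r == j) - G j q *+ (r == q)) : 'M[R]_n)) r q =
  (G i j * G i q) *+ (r == i) - (G i j * G j q) *+ (r == j) + (G i q * G j q) *+ (r == q).
Proof.
rewrite G_new_mulE.
have -> : \sum_l G i l * (\matrix_(r, q) (G j q *+ (r == j) - G j q *+ (r == q))) l q =
          G i j * G j q - G i q * G j q.
  under eq_bigr => l _ do rewrite mxE mulrBr !mulrnAr.
  rewrite sumrB; congr (_ - _).
    by rewrite (bigD1 j) //= eqxx mulr1n big1 ?addr0 // => l /negPf->.
  by rewrite (bigD1 q) //= eqxx mulr1n big1 ?addr0 // => l /negPf->.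
have /eqP := ks_arnold_all i j q; rewrite /arnold addrAC subr_eq0 => /eqP->.
rewrite mxE mulrBr !mulrnAr opprB -[RHS]addrA; congr (_ + _); rewrite addrC.
by congr (_ - _); [case: (r =P q) => [->|] | case: (r =P j) => [->|]].
Qed.

Lemma ext_GG_new_new i j : ext_G_new i * ext_G_new j = - (ext_G_new j * ext_G_new i).
Proof.
rewrite /ext_G_new !low_mxM low_mxN !mul0mx !mulmx0 !add0r oppr0.
congr low_mx; apply/matrixP => r q; rewrite [in RHS]mxE.
  by rewrite !G_newC (ks_Gp_all _ _ (hb_homog q)) (ks_sym S i j) opprB.
rewrite !G_newD (ks_GG S i q j q) (ks_sym S i j) !opprD !opprK mulNrn.
by congr (_ + _); rewrite addrC.
Qed.

Lemma ext_arnold_new i j :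
  ext_G_new i * ext_G_new j = ext_G_old i j * ext_G_new j - ext_G_old i j * ext_G_new i.
Proof.
rewrite /ext_G_new /ext_G_old !low_mxM low_mxN low_mxD !mul0mx !mulmx0 !add0r ?oppr0 ?addr0.
congr low_mx; apply/matrixP => r q; rewrite [RHS]mxE [X in _ = _ + X]mxE.
  rewrite G_newC !mul_diag_mx !mxE !mulrnAr !mulNr -!mulNrn !opprK addrC.
  by rewrite (ks_Gp_all _ _ (hb_homog q)).
rewrite G_newD !mul_diag_mx !mxE !mulrBr !mulrnAr !mulNr !mulNrn !opprB !opprK.
have /eqP := ks_arnold_all i j q; rewrite /arnold subr_eq0 => /eqP <-.
rewrite mulrnBl; move: (_ *+ _) (_ *+ _) (_ *+ _) (_ *+ _) => a1 a2 a3 a4.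
by rewrite [RHS]addrA [RHS]addrC !addrA.
Qed.

Lemma ext_p_G_old (i j : 'I_n) x : (i < j)%N ->
  ext_p_old j x * ext_G_old i j = ext_p_old i x * ext_G_old i j.
Proof.
move=> ij; rewrite /ext_p_old /ext_G_old !low_mxM !mul0mx !mulmx0 ?addr0.
congr low_mx; apply/matrixP => r q; rewrite ?mul_diag_mx !mxE !mulrnAr.
  by rewrite !mulrA !commr_sign -!mulrA (ks_p_G S _ ij).
by rewrite !mulrN (ks_p_G S _ ij).
Qed.

Lemma ext_p_G_new i x : ext_p_new x * ext_G_new i = ext_p_old i x * ext_G_new i.
Proof.
rewrite /ext_p_old /ext_p_new /ext_G_new !low_mxM !mul0mx !mulmx0 ?add0r.
congr low_mx; apply/matrixP => r q; rewrite ?mul_diag_mx !mxE.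
  by rewrite !mulrnAr; case: (r =P i) => [->|].
rewrite !mulrBr !mulrnAr; congr (_ - _); first by case: (r =P i) => [->|].
by case: (r =P q) => [->|]; rewrite ?mulr0n // ks_p_G_all.
Qed.

Lemma ext_arnold_old (i j k : 'I_n) : (i < j)%N -> (j < k)%N ->
  ext_G_old i k * ext_G_old j k =
  ext_G_old i j * ext_G_old j k - ext_G_old i j * ext_G_old i k.
Proof.
move=> ij jk; rewrite /ext_G_old !low_mxM low_mxN low_mxD !mul0mx !mulmx0 ?addr0 ?oppr0
  ?addr0.
congr low_mx; apply/matrixP => r q;
  rewrite [RHS]mxE [X in _ = _ + X]mxE !mul_diag_mx !mxE !mulrnAr.
  rewrite -mulrnBl; congr (_ *+ _).
  by rewrite !signMM (ks_arnold S ij jk).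
by rewrite !mulrNN -mulrnBl (ks_arnold S ij jk).
Qed.

Lemma kriz_system_ext : kriz_system ext_c ext_p ext_G.
Proof.
split.
- move=> a x; rewrite /GRing.comm /=.
  by apply/matrixP => i j;
    rewrite -!mulmxE -!diag_const_mx mul_mx_diag mul_diag_mx !mxE ks_C.
- by move=> i a x y; rewrite /ext_p; case: unlift => [j|];
  [apply: ext_p_old_lin|apply: ext_p_new_lin].
- by move=> i; rewrite /ext_p; case: unlift => [j|]; [apply: ext_p_old1|apply: ext_p_new1].
- by move=> i x y; rewrite /ext_p; case: unlift => [j|];
  [apply: ext_p_oldM|apply: ext_p_newM].
- move=> i j k l x y xk yl; rewrite /ext_p.
  case: unlift => [i'|]; case: unlift => [j'|].
  + exact: ext_p_old_old.
  + exact: ext_p_old_new.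
  + by rewrite (ext_p_old_new _ yl xk) mulnC signrMK.
  + exact: ext_p_new_new.
- move=> i j h k x xk; rewrite /ext_p /ext_G.
  case: unlift => [i'|]; case: unlift => [j'|]; case: unlift => [h'|];
    rewrite ?mulr0 ?mul0r ?mulr0 //.
  + exact: ext_pG_old_old.
  + exact: ext_pG_old_new.
  + exact: ext_pG_old_new.
  + exact: ext_pG_new_old.
  + exact: ext_pG_new_new.
  + exact: ext_pG_new_new.
- move=> i j h l; rewrite /ext_G.
  case: unlift => [i'|]; case: unlift => [j'|]; case: unlift => [h'|];
    case: unlift => [l'|];
    rewrite ?mulr0 ?mul0r ?oppr0 //; first [exact: ext_GG_old_old | exact: ext_GG_old_new
    | exact: ext_GG_new_new | by rewrite ext_GG_old_new opprK].
- move=> i; rewrite /ext_G; case: unlift => [j|] //.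
  have <- : low_mx 0 0 0 = 0 by apply: (@block_mx0 R b n b n).
  rewrite /ext_G_old (ks_diag S); congr low_mx; apply/matrixP => r q;
  by rewrite !mxE ?mulr0 ?oppr0 mul0rn.
- move=> i j; rewrite /ext_G; case: unlift => [i'|]; case: unlift => [j'|] //.
  by rewrite /ext_G_old (ks_sym S).
- move=> i j x ij; rewrite /ext_p /ext_G.
  have [i' iE|i0] := unliftP ord_max i; last by move: ij; rewrite i0 ltnNge leq_ord.
  case: (unliftP ord_max j) => [j' jE|_]; last exact: ext_p_G_new.
  by apply: ext_p_G_old; move: ij; rewrite iE jE !lift_max.
- move=> i j k ij jk; rewrite /ext_G.
  have [j' jE|j0] := unliftP ord_max j; last by move: jk; rewrite j0 ltnNge leq_ord.
  have [i' iE|i0] := unliftP ord_max i; last by move: ij; rewrite i0 ltnNge leq_ord.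
  case: (unliftP ord_max k) => [k' kE|_]; last exact: ext_arnold_new.
  by apply: ext_arnold_old; [move: ij | move: jk]; rewrite ?kE ?iE jE !lift_max.
Qed.

End Extension.

(** * Linear independence of the normal monomials *)

Section Words.
Variables (m : nat) (H : cohomology_ring m) (B : homogeneous_basis H).
Local Notation idx := 'I_(hb_size B).+1.
Local Notation x_ := (tnth (hb_elt B)).

Section SystemWords.
Variables (n : nat) (R : nzRingType) (p : 'I_n -> H -> R) (G : 'I_n -> 'I_n -> R).

(* A function [s] encodes the monomial having at each vertex [j] either the
   factor p_j^* x_k (when s j = inl k) or G_ij (when s j = inr i). *)
Definition letter (j : 'I_n) (a : idx + 'I_n) : R :=
  match a with inl k => p j (x_ k) | inr i => G i j end.

(** Vertices are taken in decreasing order, so the factor at the last vertex stands leftmost and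
    acts last on the column of [1]. *)
Definition word_of (s : {ffun 'I_n -> idx + 'I_n}) : R :=
  \prod_(j <- rev (enum 'I_n)) letter j (s j).

End SystemWords.

Definition valid n (s : {ffun 'I_n -> idx + 'I_n}) :=
  [forall j, if s j is inr i then (i < j)%N else true].

Lemma validP n (s : {ffun 'I_n -> idx + 'I_n}) j i : valid s -> s j = inr i -> (i < j)%N.
Proof. by move=> /forallP/(_ j) + sj; rewrite sj. Qed.

(** In a valid [s] no edge starts at the last vertex, so the default values here and in [last_slot]
    are never reached. *)
Definition restrict n (s : {ffun 'I_n.+1 -> idx + 'I_n.+1}) : {ffun 'I_n -> idx + 'I_n} :=
  [ffun j => match s (lift ord_max j) with
    | inl k => inl k
    | inr i => if unlift ord_max i is Some i' then inr i' else inl ord0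
    end].

Definition last_slot n (s : {ffun 'I_n.+1 -> idx + 'I_n.+1}) : 'I_((hb_size B).+1 + n) :=
  match s ord_max with
  | inl k => lshift n k
  | inr i => if unlift ord_max i is Some i' then rshift (hb_size B).+1 i' else lshift n ord0
  end.

Lemma valid_lift n (s : {ffun 'I_n.+1 -> idx + 'I_n.+1}) j i :
  valid s -> s j = inr i -> exists i', i = lift ord_max i'.
Proof.
move=> vs sj; case: (unliftP ord_max i) => [i' ->|im]; first by exists i'.
by have := validP vs sj; rewrite im ltnNge leq_ord.
Qed.

Lemma restrict_valid n (s : {ffun 'I_n.+1 -> idx + 'I_n.+1}) : valid s -> valid
  (restrict s).
Proof.
move=> vs; apply/forallP => j; rewrite ffunE.
case sj: (s _) => [//|i]; have [i' ii] := valid_lift vs sj.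
by have := validP vs sj; rewrite ii liftK !lift_max.
Qed.

Lemma restrict_inj n (s t : {ffun 'I_n.+1 -> idx + 'I_n.+1}) : valid s -> valid t ->
  restrict s = restrict t -> last_slot s = last_slot t -> s = t.
Proof.
move=> vs vt rst lst; apply/ffunP => j; case: (unliftP ord_max j) => [j' ->|->].
  have /ffunP/(_ j') := rst; rewrite !ffunE.
  case sj: (s _) => [k|i]; case tj: (t _) => [k'|i'].
  - by move=> [->].
  - by have [i1 ->] := valid_lift vt tj; rewrite liftK.
  - by have [i1 ->] := valid_lift vs sj; rewrite liftK.
  have [i1 ->] := valid_lift vs sj; have [i2 ->] := valid_lift vt tj.
  by rewrite !liftK => -[->].
move: lst; rewrite /last_slot.
case sj: (s _) => [k|i]; case tj: (t _) => [k'|i'].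
- by move=> /lshift_inj->.
- by have [i1 ->] := valid_lift vt tj; rewrite liftK => /eqP; rewrite eq_lrshift.
- by have [i1 ->] := valid_lift vs sj; rewrite liftK => /eqP; rewrite eq_rlshift.
have [i1 ->] := valid_lift vs sj; have [i2 ->] := valid_lift vt tj.
by rewrite !liftK => /rshift_inj->.
Qed.

(** * The first column of a matrix: its action on $p_{n+1}^*1=1$ *)

Section Column.
Variables (n : nat) (R : nzRingType) (c : {rmorphism rat -> R}).
Variables (p : 'I_n -> H -> R) (G : 'I_n -> 'I_n -> R).
Hypothesis S : kriz_system c p G.
Local Notation b := (hb_size B).+1.
Local Notation mx := 'M[R]_((hb_size B + n).+1).
Local Notation col0 M r := ((M : mx) r ord0).

Let ord0E : ord0 = lshift n (ord0 : 'I_b) :> 'I_(b + n).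
Proof. exact: val_inj. Qed.

Lemma low_mx_col0l T C D (k : 'I_b) : col0 (low_mx (B := B) T C D) (lshift n k) = T k ord0.
Proof. by rewrite ord0E; apply: block_mxEul. Qed.

Lemma low_mx_col0r T C D (i : 'I_n) : col0 (low_mx (B := B) T C D) (rshift b i) = C i ord0.
Proof. by rewrite ord0E; apply: block_mxEdl. Qed.

Lemma ord_sum_ind (P : 'I_(b + n) -> Prop) :
  (forall k, P (lshift n k)) -> (forall i, P (rshift b i)) -> forall r, P r.
Proof. by move=> Pl Pr r; rewrite -(splitK r); case: (split r). Qed.

Lemma sign_twist0 x : sign_twist B (hb_deg (ord0 : 'I_b)) x = x.
Proof.
rewrite /sign_twist [RHS](hb_coord B); apply: eq_bigr => k _.
by rewrite hb_deg0 mul0n expr0 mul1r.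
Qed.

Lemma ext_p_old_col0 i x (r : 'I_(b + n)) :
  col0 (ext_p_old B p i x) r = p i x *+ (r == lshift n ord0).
Proof.
elim/ord_sum_ind: r => [k|j].
  by rewrite low_mx_col0l !mxE eq_lshift; case: eqP => [->|]; rewrite ?sign_twist0.
by rewrite low_mx_col0r mxE eq_rlshift.
Qed.

Lemma ext_G_old_col0 i j (r : 'I_(b + n)) :
  col0 (ext_G_old B G i j) r = G i j *+ (r == lshift n ord0).
Proof.
elim/ord_sum_ind: r => [k|h].
  rewrite low_mx_col0l !mxE eq_lshift; case: eqP => [->|] //.
  by rewrite hb_deg0 expr0 mul1r.
by rewrite low_mx_col0r mxE eq_rlshift.
Qed.

Lemma ext_p_new_col0 k (r : 'I_(b + n)) :
  col0 (ext_p_new B c p (x_ k)) r = (r == lshift n k)%:R.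
Proof.
elim/ord_sum_ind: r => [l|h].
  by rewrite low_mx_col0l !mxE hb_one mulr1 coord_hb rmorph_nat eq_lshift.
by rewrite low_mx_col0r mxE eq_rlshift.
Qed.

Lemma ext_G_new_col0 i (r : 'I_(b + n)) :
  col0 (ext_G_new B p G i) r = (r == rshift b i)%:R.
Proof.
elim/ord_sum_ind: r => [l|h].
  by rewrite low_mx_col0l !mxE eq_lrshift.
by rewrite low_mx_col0r !mxE hb_one (ks_one S) eq_rshift.
Qed.

Lemma mul_col0 (M N : mx) a r : (forall q : 'I_(b + n), col0 N q = a *+ (q == lshift n
  ord0)) ->
  col0 (M * N) r = col0 M r * a.
Proof.
move=> Na; rewrite -mulmxE mxE (bigD1 (lshift n (ord0 : 'I_b) : 'I_(b + n))) //=.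
rewrite Na eqxx big1 ?addr0 => [|q /negPf q0]; first by rewrite -ord0E.
by rewrite Na q0 mulr0.
Qed.

(** Letters at the old vertices only multiply the coefficient of [1], and together give the word of
    the restriction. The letter at the last vertex then moves it to its own slot. *)
Lemma word_ext_col0 (t : {ffun 'I_n.+1 -> idx + 'I_n.+1}) (r : 'I_(b + n)) : valid t ->
  col0 (word_of (ext_p B c p) (ext_G B p G) t) r = word_of p G (restrict t) *+ (r ==
    last_slot t).
Proof.
move=> vt; rewrite /word_of enum_ordSr rev_rcons big_cons -map_rev big_map.
have lowE (q : 'I_(b + n)) : col0 (\prod_(j <- rev (enum 'I_n))
    letter (ext_p B c p) (ext_G B p G) (widen_ord (leqnSn n) j) (t (widen_ord (leqnSn
      n) j))) q
  = (\prod_(j <- rev (enum 'I_n)) letter p G j (restrict t j)) *+ (q == lshift n ord0).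
  elim: (rev _) q => [|j s IHs] q.
    by rewrite !big_nil mxE -ord0E.
  rewrite !big_cons (mul_col0 _ _ IHs) -mulrnAl; congr (_ * _).
  have -> : widen_ord (leqnSn n) j = lift ord_max j by apply/esym/val_inj; apply: lift_max.
  rewrite ffunE; case tj: (t _) => [k|i] /=.
    by rewrite /ext_p liftK ext_p_old_col0.
  have [i' ii] := valid_lift vt tj.
  by rewrite /ext_G ii !liftK ext_G_old_col0.
rewrite (mul_col0 _ _ lowE) -[RHS]mulr_natl; congr (_ * _).
rewrite /last_slot; case tj: (t _) => [k|i] /=.
  by rewrite /ext_p unlift_none ext_p_new_col0.
have [i' ->] := valid_lift vt tj.
by rewrite /ext_G unlift_none liftK ext_G_new_col0.
Qed.

End Column.

Local Notation kword := (word_of (@kriz_p m H _) (@kriz_G m H _)).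

(** Functionals dual to the valid words, hence independence of these words. By induction on [n]: the
    functional of [s] takes the entry [last_slot s] of the first column and applies to it the
    functional of [restrict s]. *)
Lemma kriz_coefficients (hm : (0 < m)%N) n :
  exists f : {ffun 'I_n -> idx + 'I_n} -> kriz H n -> rat,
    (forall s a x y, f s (a *: x + y) = a * f s x + f s y) /\
    (forall s t, valid s -> valid t -> f s (kword t) = (s == t)%:R).
Proof.
elim: n => [|n [f [f_lin fP]]].
  have S0 : kriz_system (H := H) (idfun : rat -> rat) (fun (i : 'I_0) _ => 0) (fun i j
    : 'I_0 => 0).
    split=> //; try by case.
    by move=> a x; apply: mulrC.
  have [e [_ _ eZ]] := kriz_universal S0.
  exists (fun _ => e); split=> [s a x y|s t _ _].
    by rewrite rmorphD; congr (_ + _); apply: eZ.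
  have -> : s = t by apply/ffunP; case.
  rewrite eqxx /word_of big1_seq ?rmorph1 // => -[] //.
have S := kriz_system_ext hm B (kriz_is_system H n).
have [e [ep eG eZ]] := kriz_universal S.
exists (fun s x => f (restrict s) (e x (last_slot s) ord0)); split=> [s a x y|s t vs vt].
  rewrite rmorphD eZ mxE -f_lin; congr (f _ (_ + _)).
  by rewrite -mulmxE mul_scalar_mx mxE /= -scalerAl mul1r.
have -> : e (kword t) = word_of (ext_p B (in_alg (kriz H n)) (@kriz_p m H n)) (ext_G B
  (@kriz_p m H n) (@kriz_G m H n)) t.
  rewrite /word_of rmorph_prod; apply: eq_bigr => j _.
  by case: (t j) => [k|i] /=; rewrite ?ep ?eG.
rewrite (word_ext_col0 (kriz_is_system H n)) //.
have f0 u : f u 0 = 0.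
  by apply: (addIr (f u 0)); rewrite -{1}[f u 0]mul1r -f_lin scaler0 !add0r.
have [lst|lst] := eqVneq (last_slot s) (last_slot t).
  rewrite mulr1n fP ?restrict_valid //; congr (nat_of_bool _)%:R.
  apply/eqP/eqP => [rst|->//]; exact: restrict_inj rst lst.
rewrite f0; case: eqP => // st; by rewrite st eqxx in lst.
Qed.

End Words.

(** * Monomials up to sign *)

Section EqSign.
Variable A : algType rat.
Implicit Types x y z : A.

(** The signs produced by reordering monomials are never computed: spans and the vanishing of
    coefficients do not depend on them. *)
Definition eq_sign x y := exists b : bool, x = (-1) ^+ b *: y.

Lemma eq_sign_refl x : eq_sign x x.
Proof. by exists false; rewrite scale1r. Qed.

Lemma eq_sign_trans y x z : eq_sign x y -> eq_sign y z -> eq_sign x z.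
Proof.
by move=> [b ->] [b' ->]; exists (b (+) b'); rewrite scalerA signr_addb.
Qed.

Lemma eq_sign_sym x y : eq_sign x y -> eq_sign y x.
Proof. by move=> [b ->]; exists b; rewrite scalerA -signr_addb addbb scale1r. Qed.

Lemma eq_sign_mull z x y : eq_sign x y -> eq_sign (z * x) (z * y).
Proof. by move=> [b ->]; exists b; rewrite scalerAr. Qed.

Lemma eq_sign_mulr z x y : eq_sign x y -> eq_sign (x * z) (y * z).
Proof. by move=> [b ->]; exists b; rewrite scalerAl. Qed.

Lemma sign_scale k x : (-1) ^+ k * x = (-1) ^+ k *: x.
Proof.
rewrite -!(signr_odd _ k); case: (odd k); rewrite ?expr0 ?expr1.
  by rewrite scaleN1r mulN1r.
by rewrite scale1r mul1r.
Qed.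

Lemma eq_sign_exp k x : eq_sign ((-1) ^+ k * x) x.
Proof. by exists (odd k); rewrite sign_scale signr_odd. Qed.

Variables (T : eqType) (f : T -> A).
Hypothesis fC : forall s t, eq_sign (f s * f t) (f t * f s).

Lemma prod_sign_comm t (l : seq T) :
  eq_sign ((\prod_(s <- l) f s) * f t) (f t * \prod_(s <- l) f s).
Proof.
elim: l => [|s l IHl]; first by rewrite big_nil mul1r mulr1; apply: eq_sign_refl.
rewrite big_cons -mulrA; apply: eq_sign_trans (eq_sign_mull _ IHl) _.
by rewrite !mulrA; apply: eq_sign_mulr.
Qed.

Lemma prod_perm_sign (l l' : seq T) : perm_eq l l' ->
  eq_sign (\prod_(s <- l) f s) (\prod_(s <- l') f s).
Proof.
elim: l l' => [|t l IHl] l' p.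
  by move/perm_size: (p); case: (l') => // _; apply: eq_sign_refl.
have tl' : t \in l' by rewrite -(perm_mem p) mem_head.
case/splitPr: tl' p => l1 l2; rewrite -cat_rcons => p.
have {}p : perm_eq l (l1 ++ l2).
  by rewrite -(perm_cons t); apply: perm_trans p _;
    rewrite cat_rcons perm_catC /= perm_cons perm_catC.
rewrite big_cons; apply: eq_sign_trans (eq_sign_mull _ (IHl _ p)) _.
rewrite !big_cat big_rcons /= mulrA; apply: eq_sign_mulr.
exact/eq_sign_sym/prod_sign_comm.
Qed.

End EqSign.

(** * Letters of a monomial, and classes acting on it *)

Section Monomials.
Variables (m : nat) (H : cohomology_ring m) (B : homogeneous_basis H).
Local Notation b := (hb_size B).+1.
Local Notation idx := 'I_(hb_size B).+1.
Local Notation x_ := (tnth (hb_elt B)).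
Local Notation w := (fund_class B).
Variables (n : nat) (A : algType rat) (p : 'I_n -> H -> A) (G : 'I_n -> 'I_n -> A).
Hypothesis S : kriz_system (in_alg A) p G.
Local Notation fn := {ffun 'I_n -> idx + 'I_n}.
Local Notation L := (letter (B := B) p G).
Local Notation "0l" := (inl ord0 : idx + 'I_n).
Local Notation wl := (inl ord_max : idx + 'I_n).

Lemma letter_sign_comm j a h c : eq_sign (L j a * L h c) (L h c * L j a).
Proof.
case: a => [k|i]; case: c => [l|i'] /=.
- by rewrite (ks_pp S j h (hb_homog k) (hb_homog l)); apply: eq_sign_exp.
- by rewrite (ks_pG S j i' h (hb_homog k)); apply: eq_sign_exp.
- by rewrite (ks_pG S h i j (hb_homog l)); apply: eq_sign_sym; apply: eq_sign_exp.
- by rewrite (ks_GG S) -mulN1r; apply: (eq_sign_exp 1).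
Qed.

Lemma letter0 j : L j 0l = 1.
Proof. by rewrite /= hb_one (ks_one S). Qed.

Definition partial_word (s : fn) (l : seq 'I_n) : A := \prod_(j <- l) L j (s j).

Definition upd (s : fn) (j : 'I_n) (a : idx + 'I_n) : fn :=
  [ffun i => if i == j then a else s i].

Lemma updE s j a : upd s j a j = a. Proof. by rewrite ffunE eqxx. Qed.
Lemma upd_neq s j a i : i != j -> upd s j a i = s i.
Proof. by move=> /negPf ij; rewrite ffunE ij. Qed.
Lemma upd_id s j : upd s j (s j) = s.
Proof. by apply/ffunP => i; rewrite ffunE; case: eqP => [->|]. Qed.
Lemma upd_upd s j a c : upd (upd s j a) j c = upd s j c.
Proof. by apply/ffunP => i; rewrite !ffunE; case: eqP. Qed.
Lemma upd_comm s i j a c : i != j -> upd (upd s i a) j c = upd (upd s j c) i a.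
Proof.
move=> ij; apply/ffunP => h; rewrite !ffunE.
by case: (h =P j) => [->|//]; rewrite eq_sym (negPf ij).
Qed.

Lemma partial_word_notin s l j a : j \notin l -> partial_word (upd s j a) l =
  partial_word s l.
Proof.
move=> jl; apply: eq_big_seq => i il; rewrite upd_neq //.
by apply: contraNneq jl => <-.
Qed.

(** The letter [0l] has value [1], so writing it at [j] deletes the factor there while the word
    stays indexed by a function on all vertices. *)
Lemma partial_word_extract s l j : uniq l -> j \in l ->
  eq_sign (partial_word s l) (L j (s j) * partial_word (upd s j 0l) l).
Proof.
move=> ul jl; have pl := perm_to_rem jl.
have lC t u : eq_sign (L t (s t) * L u (s u)) (L u (s u) * L t (s t)) by exact:
  letter_sign_comm.
apply: eq_sign_trans (prod_perm_sign lC pl) _; rewrite big_cons; apply: eq_sign_mull.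
have jr : j \notin rem j l by rewrite mem_rem_uniqF.
rewrite -/(partial_word s _) -(partial_word_notin s 0l jr).
set t := upd s j _.
have tC i h : eq_sign (L i (t i) * L h (t h)) (L h (t h) * L i (t i)) by exact:
  letter_sign_comm.
apply: eq_sign_sym; apply: eq_sign_trans (prod_perm_sign tC pl) _.
by rewrite big_cons updE letter0 mul1r; apply: eq_sign_refl.
Qed.

Local Notation word := (word_of (B := B) p G).

Lemma word_extract s j : eq_sign (word s) (L j (s j) * word (upd s j 0l)).
Proof. by apply: partial_word_extract;
  rewrite ?rev_uniq ?enum_uniq // mem_rev mem_enum. Qed.

Lemma word_upd s j a : eq_sign (word (upd s j a)) (L j a * word (upd s j 0l)).
Proof. by have := word_extract (upd s j a) j; rewrite updE upd_upd. Qed.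

Lemma sign_even k : (-1) ^+ (m.*2 * k) = 1 :> A.
Proof. by rewrite -mul2n -mulnA exprM sqrrN expr1n expr1n. Qed.

Lemma fund_class_central i j a : p i w * L j a = L j a * p i w.
Proof.
case: a => [k|h] /=.
  by rewrite (ks_pp S i j (fund_class_coh B) (hb_homog k)) sign_even mul1r.
by rewrite (ks_pG S i h j (fund_class_coh B)) sign_even mul1r.
Qed.

Definition diag i j : A :=
  \sum_k (-1) ^+ hb_deg k * (p i (x_ k) * p j (dual_basis k)).

(** Both tensor factors are moved across, and their degrees add up to the even number $2m$. *)
Lemma diag_central i j h a : diag i j * L h a = L h a * diag i j.
Proof.
rewrite /diag mulr_suml mulr_sumr; apply: eq_bigr => k _.
rewrite [RHS]mulrA commr_sign -!mulrA; congr (_ * _).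
case: a => [l|g] /=.
  rewrite (ks_pp S j h (dual_basis_homog k) (hb_homog l)) mulrA commr_sign -mulrA.
  rewrite [X in _ * X]mulrA (ks_pp S i h (hb_homog k) (hb_homog l)) !mulrA -exprD -mulnDl.
  by rewrite subnK ?hb_deg_le // sign_even mul1r.
rewrite (ks_pG S j g h (dual_basis_homog k)) mulrA commr_sign -mulrA.
rewrite [X in _ * X]mulrA (ks_pG S i g h (hb_homog k)) !mulrA -exprD -mulnDl.
by rewrite subnK ?hb_deg_le // sign_even mul1r.
Qed.

(** Holds when the connected component of [i] in the graph of the monomial carries [w]. On such an
    element the diagonal class $p_{ij}^*\Delta$ acts as $p_j^*w$. *)
Definition saturated i (y : A) := forall k x, x \in coh H k -> (0 < k)%N -> p i x * y = 0.

Lemma saturated_sign i y z : eq_sign y z -> saturated i z -> saturated i y.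
Proof. by move=> [e ->] sz k x xk k0; rewrite -scalerAr (sz _ _ xk) // scaler0. Qed.

Lemma saturated_mulr i y z : saturated i y -> saturated i (y * z).
Proof. by move=> sy k x xk k0; rewrite mulrA (sy _ _ xk) // mul0r. Qed.

Lemma diag_saturated i j y : saturated i y -> diag i j * y = p j w * y.
Proof.
move=> sy; rewrite /diag mulr_suml (bigD1 ord0) //= [X in _ + X]big1 ?addr0.
  by rewrite dual_basis0 hb_one (ks_one S) hb_deg0 expr0 !mul1r.
move=> k k0; rewrite (ks_pp S i j (hb_homog k) (dual_basis_homog k)) -!mulrA.
by rewrite (sy _ _ (hb_homog k)) ?mulr0 // lt0n; apply: contra k0 => /eqP/hb_deg_bot->.
Qed.

(* The rooted vertices form the set A: those in A \ J carry w, those in J a G_ij. *)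
Definition rooted (s : fn) i := match s i with inl k => k == ord_max | inr _ => true end.

(** By induction on [i]: at a vertex with [w] because $xw=0$ in positive degree, at the end of an
    edge $G_{hi}$ because $p_i^*x\,G_{hi}=p_h^*x\,G_{hi}$ passes to the smaller vertex [h]. The
    hypothesis stops at [i], so it survives changes at larger vertices. *)
Lemma word_saturated (s : fn) (i : 'I_n) :
  (forall j h : 'I_n, (j <= i)%N -> s j = inr h -> (h < j)%N && rooted s h) ->
  rooted s i -> saturated i (word s).
Proof.
have [k] := ubnP (i : nat); elim: k i => // k IHk i ik hs.
rewrite /rooted; case si: (s i) => [l|h].
  move/eqP=> lE; apply: saturated_sign (word_extract s i) _.
  rewrite si lE; apply: saturated_mulr => q x xq q0 /=.
  by rewrite -(ks_mul S) (fund_class_mul B xq q0) (ks_p0 S).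
move=> _; have /andP[hi rh] := hs _ _ (leqnn i) si.
have sh : saturated h (word s).
  apply: IHk => //; first by apply: leq_trans hi _.
  by move=> j h' jh; apply: hs; apply: leq_trans jh (ltnW hi).
move=> q x xq q0; have [e eE] := word_extract s i.
have := sh q x xq q0; rewrite eE -!scalerAr !mulrA si /=.
by rewrite (ks_p_G S x hi).
Qed.

End Monomials.

(** * The contraction *)

Section LinearSpan.
Variable V : lmodType rat.
Implicit Types (S T : V -> Prop) (x y : V).

Lemma lspan_in S x : S x -> lspan S x.
Proof.
move=> Sx; exists [:: (1, x)]; last by rewrite big_seq1 scale1r.
by move=> c; rewrite inE => /eqP->.
Qed.

Lemma lspan0 S : lspan S 0.
Proof. by exists [::] => //; rewrite big_nil. Qed.

Lemma lspan_lin S a x y : lspan S x -> lspan S y -> lspan S (a *: x + y).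
Proof.
move=> [s Ss ->] [t St ->]; exists ([seq (a * c.1, c.2) | c <- s] ++ t).
  move=> c; rewrite mem_cat => /orP[/mapP[c' c's ->]|]; [exact: (Ss c' c's) | exact: St].
rewrite big_cat big_map scaler_sumr; congr (_ + _).
by apply: eq_bigr => c _; rewrite scalerA.
Qed.

Lemma lspanD S x y : lspan S x -> lspan S y -> lspan S (x + y).
Proof. by move=> Sx Sy; rewrite -[x]scale1r; apply: lspan_lin. Qed.

Lemma lspanZ S a x : lspan S x -> lspan S (a *: x).
Proof. by move=> Sx; rewrite -[_ *: _]addr0; apply: lspan_lin => //; apply: lspan0. Qed.

Lemma lspan_sum S (I : Type) (r : seq I) (P : pred I) (f : I -> V) :
  (forall i, P i -> lspan S (f i)) -> lspan S (\sum_(i <- r | P i) f i).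
Proof.
move=> Sf; elim/big_rec: _ => [|i x Pi Sx]; first exact: lspan0.
by apply: lspanD => //; apply: Sf.
Qed.

Lemma lspan_ind S (Q : V -> Prop) : Q 0 ->
  (forall a x y, Q x -> Q y -> Q (a *: x + y)) -> (forall x, S x -> Q x) ->
  forall x, lspan S x -> Q x.
Proof.
move=> Q0 QD QS x [s + ->]; elim: s => [|c s IHs] Ss; first by rewrite big_nil.
rewrite big_cons; apply: QD; first by apply/QS/Ss; rewrite mem_head.
by apply: IHs => c' c's; apply: Ss; rewrite in_cons c's orbT.
Qed.

Lemma lspan_sub S T : (forall x, S x -> lspan T x) -> forall x, lspan S x -> lspan T x.
Proof. by apply: lspan_ind; [apply: lspan0 | move=> *; apply: lspan_lin]. Qed.

End LinearSpan.

(** * The linear algebra of the contraction *)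

Section FormalContraction.
Variables (V : lmodType rat) (d : {linear V -> V}) (I : finType) (T : pred I).
Variables (W F : I -> V) (D : I -> I -> rat).
Hypothesis dW : forall s, T s -> d (W s) = \sum_(t | T t) D s t *: W t.
Hypothesis dF : forall s, T s -> d (F s) = W s - \sum_(t | T t) D s t *: F t.
Hypothesis indep : forall a b : I -> rat,
  \sum_(s | T s) (a s *: W s + b s *: F s) = 0 -> forall s, T s -> a s = 0.

Lemma formal_acyclic (a b : I -> rat) x :
  x = \sum_(s | T s) (a s *: W s + b s *: F s) -> d x = 0 ->
  d (\sum_(s | T s) a s *: F s) = x.
Proof.
have exch (e : I -> rat) (X : I -> V) :
    \sum_(s | T s) e s *: (\sum_(t | T t) D s t *: X t) =
    \sum_(t | T t) (\sum_(s | T s) e s * D s t) *: X t.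
  under eq_bigr => s _ do rewrite scaler_sumr.
  rewrite exchange_big; apply: eq_bigr => t _ /=; rewrite scaler_suml.
  by apply: eq_bigr => s _; rewrite scalerA.
move=> -> dx; pose c t := \sum_(s | T s) a s * D s t.
(* [c t + b t] is the coefficient of [W t] in [d x]. Once it vanishes, the coefficient [- c t] of
   [F t] in the boundary of $\sum_s a_sF_s$ is [b t]. *)
have cb t : T t -> c t + b t = 0.
  move=> Tt; apply: (@indep (fun t => c t + b t) (fun t => - \sum_(s | T s) b s * D s
    t)) => //.
  rewrite -[RHS]dx linear_sum big_split /=.
  under eq_bigr => s _ do rewrite scalerDl.
  rewrite big_split -addrA /= [X in X + _](_ : _ = \sum_(s | T s) a s *: d (W s));
    last first.
    by rewrite -exch; apply: eq_bigr => s Ts; rewrite dW.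
  rewrite [X in _ + X](_ : _ = \sum_(s | T s) b s *: d (F s)); last first.
    under [RHS]eq_bigr => s Ts do rewrite dF // scalerBr.
    rewrite sumrB exch; congr (_ + _); rewrite -sumrN.
    by apply: eq_bigr => s _; rewrite scaleNr.
  by rewrite -big_split; apply: eq_bigr => s _ /=; rewrite linearD !linearZ.
rewrite linear_sum.
under eq_bigr => s Ts do rewrite linearZ /= dF // scalerBr.
rewrite sumrB exch big_split /=; congr (_ + _); rewrite -sumrN.
apply: eq_bigr => t Tt; rewrite -scaleNr; congr (_ *: _).
by apply/eqP; rewrite eq_sym -addr_eq0 addrC; apply/eqP/cb.
Qed.

End FormalContraction.

Section Contraction.
Variables (m : nat) (H : cohomology_ring m) (B : homogeneous_basis H).
Local Notation b := (hb_size B).+1.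
Local Notation idx := 'I_(hb_size B).+1.
Local Notation x_ := (tnth (hb_elt B)).
Local Notation w := (fund_class B).
Variables (n : nat) (A : algType rat) (p : 'I_n -> H -> A) (G : 'I_n -> 'I_n -> A).
Hypothesis S : kriz_system (in_alg A) p G.
Local Notation fn := {ffun 'I_n -> idx + 'I_n}.
Local Notation L := (letter (B := B) p G).
Local Notation pword := (partial_word (B := B) p G).
Local Notation word := (word_of (B := B) p G).
Local Notation diag := (diag B p).
Local Notation "0l" := (inl ord0 : idx + 'I_n).
Local Notation wl := (inl ord_max : idx + 'I_n).

Variable d : {linear A -> A}.
Hypothesis d1 : d 1 = 0.
Hypothesis d_p : forall i k y, d (p i (x_ k) * y) = (-1) ^+ hb_deg k *: (p i (x_ k) * d y).
Hypothesis d_G : forall i j y, i != j -> d (G i j * y) = diag i j * y - G i j * d y.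

(** By the Leibniz rule each edge in turn becomes a diagonal class. That class is central and can be
    put in front; the Leibniz sign is absorbed into [e j]. *)
Lemma d_pword (s : fn) l : uniq l -> (forall j i, s j = inr i -> i != j) ->
  exists e : 'I_n -> rat, d (pword s l) =
    \sum_(j <- l) if s j is inr i then e j *: (diag i j * pword (upd s j 0l) l) else 0.
Proof.
move=> + hs; elim: l => [|j l IHl] /=.
  by move=> _; exists (fun=> 0); rewrite /partial_word !big_nil.
move=> /andP[jl /IHl[e dE]]; rewrite /partial_word !big_cons -/(pword s l).
have tail (a : rat) : a *: (L j (s j) * d (pword s l)) =
    \sum_(h <- l) if s h is inr i then
      (a * e h) *: (diag i h * pword (upd s h 0l) (j :: l)) else 0.
  rewrite dE mulr_sumr scaler_sumr; apply: eq_big_seq => h hl.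
  case: (s h) => [k|i]; first by rewrite mulr0 scaler0.
  rewrite -scalerAr scalerA; congr (_ *: _).
  rewrite /partial_word big_cons mulrA -(diag_central S) -mulrA.
  by rewrite upd_neq //; apply: contraNneq jl => ->.
have [a aE] : exists a : rat, d (L j (s j) * pword s l) =
    (if s j is inr i then diag i j * pword (upd s j 0l) (j :: l) else 0) +
    a *: (L j (s j) * d (pword s l)).
  case sj: (s j) => [k|i] /=.
    by exists ((-1) ^+ hb_deg k); rewrite add0r d_p.
  exists (-1); rewrite d_G ?(hs _ _ sj) // scaleN1r.
  by rewrite /partial_word big_cons updE (letter0 B S) mul1r -!/(pword _ _)
    partial_word_notin.
exists (fun h => if h == j then 1 else a * e h).
rewrite aE tail big_cons eqxx; congr (_ + _); first by case: (s j) => // i; rewrite scale1r.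
apply: eq_big_seq => h hl; case: (s h) => // i.
by case: eqP => // hj; rewrite -hj hl in jl.
Qed.

Lemma d_word (s : fn) : valid s ->
  exists e : 'I_n -> rat, d (word s) =
    \sum_j if s j is inr i then e j *: (diag i j * word (upd s j 0l)) else 0.
Proof.
move=> vs; have hs j i : s j = inr i -> i != j.
  by move=> /(validP vs); rewrite ltn_neqAle => /andP[].
have ul : uniq (rev (enum 'I_n)) by rewrite rev_uniq enum_uniq.
have [e eE] := d_pword ul hs; exists e; rewrite -[word s]/(pword _ _) eE.
rewrite -big_enum; apply: perm_big; exact: permEl (perm_rev _).
Qed.

Definition closed_fn (s : fn) := [forall j, if s j is inr i then rooted s i else true].
(** These functions encode the generators of the spaces $E_*^{Top}(A,\beta)$, with $A$ the set of
    rooted vertices: [closed_fn] says that edges start in $A$, and $\beta$ avoids [w] because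
    vertices carrying [w] are rooted. *)
Definition good (s : fn) :=
  [&& valid s, closed_fn s & (1 < #|[set j | rooted s j]|)%N].

Lemma closed_fnP (s : fn) j i : closed_fn s -> s j = inr i -> rooted s i.
Proof. by move=> /forallP/(_ j) + sj; rewrite sj. Qed.

(** An edge ends at its larger vertex [j], so deleting it changes nothing at the vertices up to [i],
    which are the ones that matter for saturation at [i]. *)
Lemma saturated_removed (s : fn) j i : valid s -> closed_fn s -> s j = inr i ->
  saturated p i (word (upd s j 0l)).
Proof.
move=> vs cs sj; have ij := validP vs sj.
have keep (h : 'I_n) : (h <= i)%N -> upd s j 0l h = s h.
  by move=> hi; rewrite upd_neq // -val_eqE neq_ltn (leq_ltn_trans hi ij).
apply: (word_saturated S) => [h g hi|]; last first.
  by rewrite /rooted keep //; apply: closed_fnP cs sj.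
rewrite keep // => sh; have gh := validP vs sh; rewrite gh /=.
by rewrite /rooted keep; [apply: closed_fnP cs sh | apply: leq_trans (ltnW gh) hi].
Qed.

Lemma rooted_upd (s : fn) j a : rooted s j ->
  (if a is inl k then k == ord_max else true) -> rooted (upd s j a) =1 rooted s.
Proof.
by move=> sj ja i; rewrite /rooted ffunE; case: eqP => [->|//]; rewrite ja [RHS]sj.
Qed.

Lemma good_upd_w (s : fn) j : good s -> rooted s j -> good (upd s j wl).
Proof.
move=> /and3P[vs cs ns] sj; have rE := @rooted_upd s j wl sj (eqxx _).
apply/and3P; split; last by rewrite (eq_card (B := [set j | rooted s j])) // => i;
  rewrite !inE rE.
  by apply/forallP => i; rewrite ffunE; case: eqP => // _; apply: (forallP vs).
apply/forallP => i; rewrite ffunE; case: eqP => // _.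
by have := forallP cs i; case: (s i) => // h; rewrite rE.
Qed.

Lemma good_upd_G (s : fn) (j i : 'I_n) : good s -> rooted s j -> rooted s i -> (i < j)%N ->
  good (upd s j (inr i)).
Proof.
move=> /and3P[vs cs ns] sj si ij; have rE := @rooted_upd s j (inr i) sj isT.
apply/and3P; split; last by rewrite (eq_card (B := [set j | rooted s j])) // => h;
  rewrite !inE rE.
  by apply/forallP => h; rewrite ffunE; case: eqP => [->//|_]; apply: (forallP vs).
apply/forallP => h; rewrite ffunE; case: eqP => [_|_]; first by rewrite rE.
by have := forallP cs h; case: (s h) => // g; rewrite rE.
Qed.

Variable j0 : 'I_n.
(* The k-th smallest rooted vertex (the dummy j0 if there are too few). *)
Definition least (k : nat) (s : fn) := nth j0 (filter (rooted s) (enum 'I_n)) k.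
Local Notation u := (least 0).
Local Notation v := (least 1).

Lemma least_ext k (s t : fn) : rooted s =1 rooted t -> least k s = least k t.
Proof. by move=> st; rewrite /least (eq_filter st). Qed.

Lemma leastP (s : fn) : good s ->
  [/\ rooted s (u s), rooted s (v s), (u s < v s)%N &
      forall j, rooted s j -> (j < v s)%N -> j = u s].
Proof.
move=> /and3P[_ _ card2].
have : sorted ltn (map val (filter (rooted s) (enum 'I_n))).
  rewrite sorted_map; apply: sorted_filter; first by move=> ? ? ?; apply: ltn_trans.
  by rewrite -sorted_map val_enum_ord iota_ltn_sorted.
have : (1 < size (filter (rooted s) (enum 'I_n)))%N.
  move: card2; rewrite cardE; congr (_ < _)%N; apply: perm_size.
  apply: uniq_perm; [exact: enum_uniq | exact/filter_uniq/enum_uniq | move=> j].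
  by rewrite mem_filter !mem_enum inE andbT.
have memE j : (j \in filter (rooted s) (enum 'I_n)) = rooted s j.
  by rewrite mem_filter mem_enum andbT.
rewrite /least; case: (filter _ _) memE => [//|a [//|c r]] memE _ /=.
move=> /andP[ac pc]; split=> //.
- by rewrite -memE mem_head.
- by rewrite -memE !inE eqxx orbT.
move=> j; rewrite -memE !inE => /or3P[/eqP//|/eqP->|jr]; first by rewrite ltnn.
have /allP/(_ (val j)) := order_path_min ltn_trans pc.
by rewrite map_f // => /(_ isT) cj; rewrite ltnNge (ltnW cj).
Qed.

(** An edge ending at [u s] would start at a smaller rooted vertex. *)
Lemma good_u (s : fn) : good s -> s (u s) = wl.
Proof.
move=> gs; have [ru rv uv uniq_u] := leastP gs; have /and3P[vs cs _] := gs.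
case su: (s (u s)) => [k|i]; first by move: ru; rewrite /rooted su => /eqP->.
have iu := validP vs su; have := uniq_u i (closed_fnP cs su) (ltn_trans iu uv).
by move=> iE; rewrite iE ltnn in iu.
Qed.

Lemma good_v (s : fn) : good s -> s (v s) = wl \/ s (v s) = inr (u s).
Proof.
move=> gs; have [ru rv uv uniq_u] := leastP gs; have /and3P[vs cs _] := gs.
case sv: (s (v s)) => [k|i]; first by left; move: rv; rewrite /rooted sv => /eqP->.
by right; rewrite (uniq_u i (closed_fnP cs sv) (validP vs sv)).
Qed.

(** Base functions index the pairs [W], [F]. The other good functions arise from them by replacing
    [w] at the second least rooted vertex by the edge from the least one. *)
Definition base (s : fn) := good s && (s (v s) == wl).
Definition rest (s : fn) := word (upd s (v s) 0l).
Definition W (s : fn) := p (v s) w * rest s.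
Definition F (s : fn) := G (u s) (v s) * rest s.

Lemma word_W (s : fn) : base s -> eq_sign (word s) (W s).
Proof. by case/andP=> _ /eqP sv; have := word_extract S s (v s); rewrite sv. Qed.

Lemma word_F (s : fn) : eq_sign (word (upd s (v s) (inr (u s)))) (F s).
Proof. exact: word_upd. Qed.

Lemma base_upd_w (s : fn) j : base s -> rooted s j ->
  [/\ base (upd s j wl), u (upd s j wl) = u s & v (upd s j wl) = v s].
Proof.
case/andP=> gs /eqP sv sj; have rE := @rooted_upd s j wl sj (eqxx _).
split; try exact: least_ext.
by rewrite /base good_upd_w //= (least_ext 1 rE) ffunE sv if_same.
Qed.

(** [W s] and [F s] have the same tail [rest s]. In its differential an edge at [j] becomes
    $p_j^*w$, whether the tail is multiplied by $p_v^*w$ or by $G_{uv}$, and [u], [v] stay the least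
    rooted vertices. Hence one matrix [D] serves both formulas. *)
Lemma d_base (s : fn) : base s -> exists D : fn -> rat,
  d (W s) = \sum_(t | base t) D t *: W t /\
  d (F s) = W s - \sum_(t | base t) D t *: F t.
Proof.
move=> bs; have /andP[gs /eqP sv] := bs; have /and3P[vs cs ns] := gs.
have [ru rv uv uniq_u] := leastP gs.
set v' := v s; set u' := u s; pose s' := upd s v' 0l.
have vs' : valid s'.
  by apply/forallP => j; rewrite ffunE; case: eqP => // _; apply: (forallP vs).
have [e dE] := d_word vs'.
have jv j i : s' j = inr i -> j != v'.
  by rewrite ffunE; case: eqP.
have sj j i : s' j = inr i -> s j = inr i.
  by move=> s'j; rewrite -s'j upd_neq // (jv _ _ s'j).
(* [f j] is the sign of bringing the new factor [w] to its place in the word. *)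
have /fin_all_exists[f fE] j : exists f : rat,
    p j w * word (upd s' j 0l) = f *: word (upd s' j wl).
  by have /eq_sign_sym[f fE] := word_upd S s' j wl; exists ((-1) ^+ f).
have upd_swap j : j != v' -> upd s' j wl = upd (upd s j wl) v' 0l.
  by move=> jv'; rewrite upd_comm // eq_sym.
pose step j := upd s j wl.
have stepP j i : s' j = inr i -> [/\ base (step j), u (step j) = u' & v (step j) = v'].
  by move=> /sj s_j; apply: base_upd_w; rewrite // /rooted s_j.
have termW j i : s' j = inr i ->
    p v' w * (e j *: (diag i j * word (upd s' j 0l))) = (e j * f j) *: W (step j).
  move=> s'j; have [_ _ vE] := stepP _ _ s'j; have jv' := jv _ _ s'j.
  (* Up to sign, this product is the word of [s] with only the edge at [j] deleted. *)
  have sat : saturated p i (p v' w * word (upd s' j 0l)).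
    apply: saturated_sign (saturated_removed vs cs (sj _ _ s'j)).
    have := word_extract S (upd s j 0l) v'; rewrite upd_neq ?sv 1?eq_sym //.
    by move=> /eq_sign_sym; rewrite upd_comm // eq_sym.
  rewrite -scalerAr -(scalerA (e j)); congr (_ *: _).
  rewrite mulrA -(diag_central S i j v' wl) -mulrA (diag_saturated B S j sat).
  rewrite mulrA (fund_class_central S j v' wl) -mulrA fE -scalerAr upd_swap //.
  by rewrite /W /rest vE.
have termF j i : s' j = inr i ->
    G u' v' * (e j *: (diag i j * word (upd s' j 0l))) = (e j * f j) *: F (step j).
  move=> s'j; have [_ uE vE] := stepP _ _ s'j; have jv' := jv _ _ s'j.
  have /and3P[vs1 cs1 _] := good_upd_G gs rv ru uv.
  have s1j : upd s v' (inr u') j = inr i by rewrite upd_neq // (sj _ _ s'j).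
  (* Likewise, starting from the good function that has the edge from [u'] at [v']. *)
  have sat : saturated p i (G u' v' * word (upd s' j 0l)).
    apply: saturated_sign (saturated_removed vs1 cs1 s1j).
    have := word_extract S (upd (upd s v' (inr u')) j 0l) v'.
    rewrite upd_neq 1?eq_sym // updE (@upd_comm _ _ _ _ _ j) // upd_upd.
    by move/eq_sign_sym.
  rewrite -scalerAr -(scalerA (e j)); congr (_ *: _).
  rewrite mulrA -(diag_central S i j v' (inr u')) -mulrA (diag_saturated B S j sat).
  rewrite mulrA (fund_class_central S j v' (inr u')) -mulrA fE -scalerAr upd_swap //.
  by rewrite /F /rest uE vE.
pose P j := if s' j is inr _ then true else false.
(* Summing over all edges with the same [step j] allows regrouping without showing that [step] is
   injective. *)
exists (fun t => \sum_(j | P j && (step j == t)) e j * f j).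
have regroup (X : fn -> A) : \sum_(j | P j) (e j * f j) *: X (step j) =
    \sum_(t | base t) (\sum_(j | P j && (step j == t)) e j * f j) *: X t.
  rewrite (partition_big step base) => [|j]; last first.
    by rewrite /P; case s'j: (s' j) => // _; have [] := stepP _ _ s'j.
  apply: eq_bigr => t _; rewrite scaler_suml.
  by apply: eq_bigr => j /andP[_ /eqP->].
split; rewrite -regroup.
  rewrite /W d_p hb_top -[(-1) ^+ _]mul1r -mul2n exprM sqrrN !expr1n mul1r scale1r.
  rewrite /rest -/v' -/s' dE mulr_sumr [RHS]big_mkcond /=; apply: eq_bigr => j _;
    rewrite /P.
  by case s'j: (s' j) => [k|i]; [rewrite mulr0 | apply: termW].
rewrite /F d_G; last by rewrite -val_eqE neq_ltn uv.
congr (_ - _).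
  (* The least rooted vertex carries [w] in the tail, so $p_{uv}^*\Delta$ acts on the tail as
     $p_v^*w$ and yields [W s]. *)
  apply: (diag_saturated B S); apply: (word_saturated S) => [j h ju|].
    rewrite upd_neq; last by rewrite -val_eqE neq_ltn (leq_ltn_trans ju uv).
    move=> s_j; have jr : rooted s j by rewrite /rooted s_j.
    have jE := uniq_u _ jr (leq_ltn_trans ju uv).
    by move: s_j; rewrite jE good_u.
  by rewrite /rooted upd_neq -/u' ?good_u // -val_eqE neq_ltn uv.
rewrite /rest -/v' -/s' dE mulr_sumr [RHS]big_mkcond /=; apply: eq_bigr => j _; rewrite /P.
by case s'j: (s' j) => [k|i]; [rewrite mulr0 | apply: termF].
Qed.


(** * The span of the good words and its homology *)

Definition good_span : A -> Prop := lspan (fun x => exists2 s, good s & x = word s).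

Lemma good_span_sign x y : eq_sign x y -> good_span y -> good_span x.
Proof. by move=> [e ->]; apply: lspanZ. Qed.

Lemma good_span_word s : good s -> good_span (word s).
Proof. by move=> gs; apply: lspan_in; exists s. Qed.

Lemma good_span_W s : base s -> good_span (W s).
Proof.
move=> bs; apply: good_span_sign (eq_sign_sym (word_W bs)) (good_span_word _).
by case/andP: bs.
Qed.

Lemma good_span_F s : base s -> good_span (F s).
Proof.
case/andP=> gs _; apply: good_span_sign (eq_sign_sym (word_F s)) (good_span_word _).
by have [ru rv uv _] := leastP gs; apply: good_upd_G.
Qed.

Lemma good_word_cases s : good s ->
  exists2 t, base t & eq_sign (word s) (W t) \/ eq_sign (word s) (F t).
Proof.
move=> gs; have [ru rv uv _] := leastP gs; case: (good_v gs) => sv.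
  have bs : base s by rewrite /base gs sv eqxx.
  by exists s => //; left; apply: word_W.
have rE := @rooted_upd s (v s) wl rv (eqxx _).
exists (upd s (v s) wl).
  by rewrite /base good_upd_w //= (least_ext 1 rE) updE.
right; have := word_F (upd s (v s) wl).
by rewrite (least_ext 1 rE) (least_ext 0 rE) upd_upd -sv upd_id.
Qed.

Lemma good_span_decomp x : good_span x ->
  exists a c : fn -> rat, x = \sum_(s | base s) (a s *: W s + c s *: F s).
Proof.
have single (X : fn -> A) t : base t -> X t = \sum_(s | base s) (s == t)%:R *: X s.
  move=> bt; rewrite (bigD1 t) //= eqxx scale1r big1 ?addr0 // => s /andP[_ /negPf->].
  exact: scale0r.
move: x; apply: lspan_ind.
- exists (fun=> 0), (fun=> 0); rewrite big1 // => s _.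
  by rewrite !scale0r addr0.
- move=> e x y [a [c ->]] [a' [c' ->]].
  exists (fun s => e * a s + a' s), (fun s => e * c s + c' s).
  rewrite scaler_sumr -big_split; apply: eq_bigr => s _ /=.
  by rewrite !scalerDl scalerDr !scalerA addrACA.
move=> _ [s /good_word_cases[t bt wt] ->].
case: wt => -[e ->].
  exists (fun s => (-1) ^+ e * (s == t)%:R), (fun=> 0).
  rewrite (single W t bt) scaler_sumr; apply: eq_bigr => h _.
  by rewrite scalerA scale0r addr0.
exists (fun=> 0), (fun s => (-1) ^+ e * (s == t)%:R).
rewrite (single F t bt) scaler_sumr; apply: eq_bigr => h _.
by rewrite scalerA scale0r add0r.
Qed.

Lemma good_span_d x : good_span x -> good_span (d x).
Proof.
move: x; apply: lspan_ind.
- by rewrite linear0; apply: lspan0.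
- by move=> a x y sx sy; rewrite linearP; apply: lspan_lin.
move=> _ [s /good_word_cases[t bt wt] ->]; have [D [dW dF]] := d_base bt.
case: wt => -[e ->]; rewrite linearZ /=; apply: lspanZ.
  rewrite dW; apply: lspan_sum => h bh; apply: lspanZ; exact: good_span_W.
rewrite dF -scaleN1r addrC; apply: lspan_lin; last exact: good_span_W.
apply: lspan_sum => h bh; apply: lspanZ; exact: good_span_F.
Qed.

Section Acyclic.
Variable f : fn -> A -> rat.
Hypothesis f_lin : forall s a x y, f s (a *: x + y) = a * f s x + f s y.
Hypothesis f_word : forall s t, valid s -> valid t -> f s (word t) = (s == t)%:R.

(** The functional of [s] vanishes on every [F t]: the word of [F t] has an edge at the second least
    rooted vertex, where a base function has [w]. *)
Lemma base_indep (a c : fn -> rat) :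
  \sum_(s | base s) (a s *: W s + c s *: F s) = 0 -> forall s, base s -> a s = 0.
Proof.
move=> sum0 s bs; have /andP[gs /eqP sv] := bs; have /and3P[vs _ _] := gs.
have f0 : f s 0 = 0.
  by apply: (addIr (f s 0)); rewrite -{1}[f s 0]mul1r -f_lin scaler0 !add0r.
have fZ e x : f s (e *: x) = e * f s x by rewrite -[e *: x]addr0 f_lin f0 addr0.
have fD x y : f s (x + y) = f s x + f s y by rewrite -[x]scale1r f_lin mul1r scale1r.
have fW t : base t -> t != s -> f s (W t) = 0.
  move=> bt ts; have [e ->] := eq_sign_sym (word_W bt); have /andP[/and3P[vt _ _] _] := bt.
  by rewrite fZ f_word // eq_sym (negPf ts) mulr0.
have fF t : base t -> f s (F t) = 0.
  move=> /andP[gt _]; have [e ->] := eq_sign_sym (word_F t).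
  have [ru rv uv _] := leastP gt; have /and3P[v1 _ _] := good_upd_G gt rv ru uv.
  rewrite fZ f_word //; case: eqP => [sE|]; last by rewrite mulr0.
  have rE := @rooted_upd t (v t) (inr (u t)) rv isT.
  by move: sv; rewrite sE (least_ext 1 rE) updE.
have [e eE] := eq_sign_sym (word_W bs).
have := congr1 (f s) sum0;
  rewrite f0 (big_morph _ fD f0) (bigD1 s) //= big1 => [|t /andP[bt ts]].
  rewrite addr0 fD !fZ (fF _ bs) mulr0 addr0 eE fZ f_word // eqxx mulr1 => /eqP.
  by rewrite mulf_eq0 signr_eq0 orbF => /eqP.
by rewrite fD !fZ fW // fF // !mulr0 addr0.
Qed.

Lemma good_span_acyclic x : good_span x -> d x = 0 -> exists2 y, good_span y & d y = x.
Proof.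
move=> /good_span_decomp[a [c xE]] dx.
have /fin_all_exists[D DE] s : exists Ds : fn -> rat, base s ->
    d (W s) = \sum_(t | base t) Ds t *: W t /\
    d (F s) = W s - \sum_(t | base t) Ds t *: F t.
  have [bs|nbs] := boolP (base s); last by exists (fun=> 0).
  by have [Ds DsE] := d_base bs; exists Ds.
exists (\sum_(s | base s) a s *: F s).
  by apply: lspan_sum => s bs; apply: lspanZ; apply: good_span_F.
apply: (formal_acyclic (D := D) _ _ _ xE dx) => [s bs|s bs|].
- by have [] := DE s bs.
- by have [] := DE s bs.
exact: base_indep.
Qed.

End Acyclic.

End Contraction.

(** * Invariance under the symmetric group *)

Section Symmetry.
Variables (m : nat) (H : cohomology_ring m) (B : homogeneous_basis H).
Local Notation idx := 'I_(hb_size B).+1.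
Local Notation x_ := (tnth (hb_elt B)).
Local Notation w := (fund_class B).
Variables (n : nat) (A : algType rat) (p : 'I_n -> H -> A) (G : 'I_n -> 'I_n -> A).
Hypothesis S : kriz_system (in_alg A) p G.
Local Notation fn := {ffun 'I_n -> idx + 'I_n}.
Local Notation L := (letter (B := B) p G).
Local Notation word := (word_of (B := B) p G).
Local Notation good_span := (good_span B p G).
Local Notation "0l" := (inl ord0 : idx + 'I_n).
Local Notation wl := (inl ord_max : idx + 'I_n).

Definition perm_letter (s : 'S_n) (a : idx + 'I_n) : idx + 'I_n :=
  match a with inl k => inl k | inr i => inr (s i) end.

(** Relabelling of vertices. It keeps [closed_fn] and the number of rooted vertices, but may destroy
    [valid]. *)
Definition perm_fn (s : 'S_n) (t : fn) : fn :=
  [ffun j => perm_letter s (t (s^-1%g j))].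

Lemma perm_fnE s t j : perm_fn s t (s j) = perm_letter s (t j).
Proof. by rewrite ffunE permK. Qed.

Lemma rooted_perm s t j : rooted (perm_fn s t) (s j) = rooted t j.
Proof. by rewrite /rooted perm_fnE; case: (t j). Qed.

Lemma closed_perm s t : closed_fn t -> closed_fn (perm_fn s t).
Proof.
move=> ct; apply/forallP => j; rewrite -(permKV s j) perm_fnE.
by case tj: (t _) => [//|i] /=; rewrite rooted_perm; apply: closed_fnP ct tj.
Qed.

Lemma card_rooted_perm s t :
  #|[set j | rooted (perm_fn s t) j]| = #|[set j | rooted t j]|.
Proof.
rewrite -[RHS](card_imset _ (@perm_inj _ s)); apply: eq_card => j.
have := rooted_perm s t (s^-1 j)%g; rewrite permKV inE => ->.
apply/idP/imsetP => [rj|[i + ->]]; last by rewrite permK inE.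
by exists ((s^-1)%g j); rewrite ?inE ?permKV.
Qed.

Lemma word_upd2 t j h a c : j != h ->
  eq_sign (word (upd (upd t j a) h c)) (L j a * (L h c * word (upd (upd t j 0l) h 0l))).
Proof.
move=> jh; apply: eq_sign_trans (word_upd S (upd t j a) h c) _.
rewrite upd_comm //; apply: eq_sign_trans (eq_sign_mull _ (word_upd S (upd t h 0l) j a)) _.
rewrite upd_comm 1?eq_sym // !mulrA; apply: eq_sign_mulr.
exact: letter_sign_comm.
Qed.

(** * Adjacent transpositions *)

Section AdjacentTransposition.
Variables (k k' : 'I_n) (kk' : k' = k.+1 :> nat).

Let neq_kk' : k != k'.
Proof. by rewrite -val_eqE /= kk' neq_ltn ltnSn. Qed.

Lemma good_upd2 (t : fn) (a c : idx + 'I_n) : closed_fn t -> (1 < #|[set j | rooted t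
  j]|)%N ->
  rooted t k -> rooted t k' ->
  (forall j i : 'I_n, j != k -> j != k' -> t j = inr i -> (i < j)%N) ->
  (match a with inl l => l == ord_max | inr i => (i < k)%N && rooted t i end) ->
  (match c with inl l => l == ord_max | inr i => (i < k')%N && rooted t i end) ->
  good (upd (upd t k a) k' c).
Proof.
move=> ct ht rk rk' vt ha hc; set t' := upd _ _ _.
have rE : rooted t' =1 rooted t.
  move=> j; rewrite /rooted /t' !ffunE.
  case: (j =P k') => [->|_]; first by rewrite -/(rooted t k') rk'; case: (c) hc.
  by case: (j =P k) => [->|_] //; rewrite -/(rooted t k) rk; case: (a) ha.
apply/and3P; split; last by rewrite (eq_card (B := [set j | rooted t j])) // => j;
  rewrite !inE rE.
  apply/forallP => j; rewrite !ffunE; case: (j =P k') => [->|/eqP jk'].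
    by case: (c) hc => // i /andP[].
  case: (j =P k) => [->|/eqP jk]; first by case: (a) ha => // i /andP[].
  by case tj: (t j) => [//|i]; apply: vt tj.
apply/forallP => j; rewrite ffunE; case: (j =P k') => [_|_].
  by case: (c) hc => // i /andP[_]; rewrite rE.
rewrite ffunE; case: (j =P k) => [_|_].
  by case: (a) ha => // i /andP[_]; rewrite rE.
by have := forallP ct j; case: (t j) => // i; rewrite rE.
Qed.

Lemma adjacent_perm_word t : good t -> good_span (word (perm_fn (tperm k k') t)).
Proof.
move=> /and3P[vt ct ht]; set s := tperm k k'; set t' := perm_fn s t.
have ct' : closed_fn t' by apply: closed_perm.
have ht' : (1 < #|[set j | rooted t' j]|)%N by rewrite card_rooted_perm.
have t'k : t' k = perm_letter s (t k') by rewrite -perm_fnE tpermR.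
have t'k' : t' k' = perm_letter s (t k) by rewrite -perm_fnE tpermL.
have t'j j : j != k -> j != k' -> t' j = perm_letter s (t j).
  by move=> jk jk'; rewrite -perm_fnE tpermD // eq_sym.
have r'k : rooted t' k = rooted t k' by rewrite -(rooted_perm s t k') tpermR.
have r'k' : rooted t' k' = rooted t k by rewrite -(rooted_perm s t k) tpermL.
have r'j j : j != k -> j != k' -> rooted t' j = rooted t j.
  by move=> jk jk'; rewrite -(rooted_perm s t j) tpermD // eq_sym.
(* An edge from [k] to a vertex [j] other than [k'] has [j] above [k'] too, so it stays in normal
   form. *)
have off (j i : 'I_n) : j != k -> j != k' -> t' j = inr i -> (i < j)%N.
  move=> jk jk'; rewrite t'j //; case tj: (t j) => [//|h] -[<-].
  have := validP vt tj; case: (tpermP k k' h) => [->|->|//] hj.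
    by rewrite kk' ltn_neqAle hj -kk' eq_sym jk'.
  by apply: ltn_trans hj; rewrite kk'.
have lek (i : 'I_n) : (i < k)%N -> s i = i.
  move=> ik; rewrite tpermD // -val_eqE neq_ltn; first by rewrite ik orbT.
  by rewrite /= kk' (ltn_trans ik) ?ltnSn ?orbT.
(* The edge from [k] to [k'] is the only one whose direction the transposition reverses. *)
have [bad|ok] := eqVneq (t k') (inr k); last first.
  apply: lspan_in; exists t' => //.
  apply/and3P; split=> //; apply/forallP => j.
  case: (j =P k) => [->|/eqP jk]; last case: (j =P k') => [->|/eqP jk'].
  - rewrite t'k; case tk': (t k') => [//|i] /=.
    have := validP vt tk'; rewrite kk' ltnS leq_eqVlt => /orP[/eqP/val_inj ik|ik].
      by rewrite tk' ik eqxx in ok.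
    by rewrite lek.
  - rewrite t'k'; case tk: (t k) => [//|i] /=.
    by have ik := validP vt tk; rewrite lek // kk' ltnS ltnW.
  by case tj: (t' j) => [//|i]; apply: off tj.
have rk : rooted t k by apply: closed_fnP ct bad.
have rk' : rooted t k' by rewrite /rooted bad.
rewrite -r'k' in rk; rewrite -r'k in rk'.
set z := word (upd (upd t' k 0l) k' 0l).
have wordE : eq_sign (word t') (G k k' * (L k' (t' k') * z)).
  have := word_upd2 t' (t' k) (t' k') neq_kk'.
  by rewrite !upd_id t'k bad /= tpermL (ks_sym S).
apply: good_span_sign wordE _; rewrite t'k'; move: (rk); rewrite /rooted.
case tk: (t k) => [l|i] /= rtk.
  have -> : l = ord_max by move: rk; rewrite r'k' /rooted tk => /eqP.
  pose t1 := upd (upd t' k wl) k' (inr k).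
  apply: (@good_span_sign _ _ _ _ _ _ _ _ (word t1)); last first.
    by apply: good_span_word; apply: good_upd2; rewrite ?rk' // kk' ltnSn.
  have := word_upd2 t' wl (inr k) neq_kk'.
  (* The transposition has moved [w] from [k] to [k']; in the presence of $G_{kk'}$ it may be moved
     back. *)
  have -> : L k wl * (L k' (inr k) * z) = G k k' * (p k' w * z).
    have := fund_class_central S k' k' (inr k).
    by rewrite /= !mulrA -(ks_p_G_all S k k') => ->.
  exact: eq_sign_sym.
have ik := validP vt tk; rewrite lek //.
have ik' : (i < k')%N by rewrite kk' ltnS ltnW.
have ri : rooted t' i.
  rewrite r'j; first exact: closed_fnP ct tk.
    by rewrite -val_eqE neq_ltn ik.
  by rewrite -val_eqE neq_ltn ik'.
(* Here two edges end at [k']. The Arnold relation for $i<k<k'$ gives two products in which [k] and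
   [k'] each receive one edge from a smaller vertex. *)
have -> : G k k' * (G i k' * z) = - (G i k * (G k k' * z)) + G i k * (G i k' * z).
  by rewrite !mulrA (ks_GG S k k' i k') (ks_arnold S) ?kk' // opprB mulrDl mulNr addrC.
rewrite -scaleN1r; apply: lspan_lin.
  have := word_upd2 t' (inr i) (inr k) neq_kk' => /eq_sign_sym e; apply: good_span_sign e _.
  by apply: good_span_word; apply: good_upd2; rewrite ?ik ?ri ?rk' ?kk' ?ltnSn.
have := word_upd2 t' (inr i) (inr i) neq_kk' => /eq_sign_sym e; apply: good_span_sign e _.
by apply: good_span_word; apply: good_upd2; rewrite ?ik ?ik' ?ri.
Qed.

End AdjacentTransposition.

(** * From adjacent transpositions to all permutations *)

Variable act : 'S_n -> {lrmorphism A -> A}.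
Hypothesis act_p : forall s i x, act s (p i x) = p (s i) x.
Hypothesis act_G : forall s i j, act s (G i j) = G (s i) (s j).

Lemma act_letter s j a : act s (L j a) = L (s j) (perm_letter s a).
Proof. by case: a => [k|i] /=. Qed.

Lemma act_word s t : eq_sign (act s (word t)) (word (perm_fn s t)).
Proof.
rewrite /word_of rmorph_prod.
rewrite (eq_bigr (fun j => L (s j) (perm_fn s t (s j)))) => [|j _]; last first.
  by rewrite perm_fnE; apply: act_letter.
rewrite -(big_map s xpredT (fun j => L j (perm_fn s t j))).
apply: prod_perm_sign => [i j|]; first exact: letter_sign_comm.
apply: uniq_perm; rewrite ?map_inj_uniq ?rev_uniq ?enum_uniq //; first exact: perm_inj.
move=> j; rewrite mem_rev mem_enum; apply/mapP; exists (s^-1 j)%g; rewrite ?permKV //.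
by rewrite mem_rev mem_enum.
Qed.

Definition preserves s := forall x, good_span x -> good_span (act s x).

Lemma preserves_words s : (forall t, good t -> good_span (act s (word t))) -> preserves s.
Proof.
move=> h; apply: lspan_ind; first by rewrite linear0; apply: lspan0.
  by move=> a x y sx sy; rewrite linearP; apply: lspan_lin.
by move=> _ [t gt ->]; apply: h.
Qed.

Lemma preserves1 : preserves 1%g.
Proof.
apply: preserves_words => t gt; apply: good_span_sign (act_word _ _) _.
have -> : perm_fn 1 t = t; last exact: good_span_word.
apply/ffunP => j; rewrite ffunE invg1 perm1.
by case: (t j) => //= i; rewrite perm1.
Qed.

Lemma preservesM s1 s2 : preserves s1 -> preserves s2 -> preserves (s1 * s2)%g.
Proof.
move=> h1 h2; apply: preserves_words => t gt.
(* Multiplicativity of [act] on words follows from its values on letters. Permutations compose from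
   left to right, so [s1] acts first. *)
have -> : act (s1 * s2)%g (word t) = act s2 (act s1 (word t)).
  rewrite /word_of !rmorph_prod; apply: eq_bigr => j _.
  have e1 := act_letter s1 j (t j); apply: etrans (act_letter _ _ _) _.
  apply: etrans (esym (congr1 (act s2) e1)); apply: etrans (esym (act_letter _ _ _)).
  rewrite permM; congr (L _ _).
  by case: (t j) => //= i; rewrite permM.
by apply: h2; apply: h1; apply: good_span_word.
Qed.

(** By induction on [j - i]: conjugation by the adjacent transposition of [j - 1] and [j] turns
    [tperm i (j - 1)] into [tperm i j]. *)
Lemma preserves_tperm_lt (i j : 'I_n) : (i < j)%N -> preserves (tperm i j).
Proof.
have [d] := ubnP (j - i); elim: d j => // d IHd j dj ij.
case: (ltngtP i.+1 j) => [ij1|ji|ij1].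
- have j1 : (j.-1 < n)%N by apply: leq_ltn_trans (leq_pred _) (ltn_ord j).
  pose h := Ordinal j1;
    have hj : j = h.+1 :> nat by rewrite /= prednK // (leq_ltn_trans _ ij).
  have ih : (i < h)%N by rewrite -ltnS -hj.
  have -> : tperm i j = (tperm h j * (tperm i h * tperm h j))%g.
    rewrite -{1}[tperm h j]tpermV -[RHS]/((tperm i h ^ tperm h j)%g) tpermJ tpermL.
    by rewrite tpermD // -val_eqE neq_ltn ?ih ?ij ?orbT.
  have adj : preserves (tperm h j).
    apply: preserves_words => t gt; apply: good_span_sign (act_word _ _) _.
    exact: adjacent_perm_word.
  apply: preservesM => //; apply: preservesM => //; apply: IHd => //.
  by rewrite -ltnS; apply: leq_trans dj; rewrite ltnS hj subSn // ltnW.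
- by move: ji; rewrite ltnNge ij.
apply: preserves_words => t gt; apply: good_span_sign (act_word _ _) _.
exact: adjacent_perm_word.
Qed.

Lemma good_span_act s x : good_span x -> good_span (act s x).
Proof.
move: x; change (preserves s); have [ts -> _] := prod_tpermP s.
elim: ts => [|[i j] ts IHts]; first by rewrite big_nil; apply: preserves1.
rewrite big_cons; apply: preservesM => //=.
case: (ltngtP i j) => [ij|ji|/val_inj->]; first exact: preserves_tperm_lt.
  by rewrite tpermC; apply: preserves_tperm_lt.
by rewrite tperm1; apply: preserves1.
Qed.

End Symmetry.

(** * Words and generators *)

Lemma prod_enum (R : nzRingType) (T : finType) (A : {pred T}) (F : T -> R) :
  \prod_(i in A) F i = \prod_(i <- enum A) F i.
Proof. by rewrite -big_filter [index_enum _]unlock. Qed.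

Section WordsOfGenerators.
Variables (m : nat) (H : cohomology_ring m) (B : homogeneous_basis H) (n : nat).
Local Notation idx := 'I_(hb_size B).+1.
Local Notation x_ := (tnth (hb_elt B)).
Local Notation w := (fund_class B).
Local Notation K := (kriz H n).
Local Notation p := (@kriz_p m H n).
Local Notation G := (@kriz_G m H n).
Local Notation S := (kriz_is_system H n).
Local Notation fn := {ffun 'I_n -> idx + 'I_n}.
Local Notation L := (letter (B := B) p G).
Local Notation word := (word_of (B := B) p G).
Local Notation good_span := (good_span B p G).
Local Notation wl := (inl ord_max : idx + 'I_n).

(** A generator lists the vertices in an order different from that of words; the association list
    [l] records it, and reordering costs a sign only. *)
Lemma assoc_word (l : seq ('I_n * (idx + 'I_n))) (s : fn) :
  uniq (unzip1 l) -> (forall j, j \in unzip1 l) -> (forall c, c \in l -> s c.1 = c.2) ->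
  eq_sign (\prod_(c <- l) L c.1 c.2 : K) (word s).
Proof.
move=> ul al sl.
have -> : (\prod_(c <- l) L c.1 c.2 : K) = \prod_(j <- unzip1 l) L j (s j).
  by rewrite big_map; apply: eq_big_seq => c /sl->.
apply: (prod_perm_sign (f := fun j => L j (s j))) => [i j|];
  first exact: letter_sign_comm S _ _ _ _.
apply: uniq_perm; rewrite ?rev_uniq ?enum_uniq // => j.
by rewrite al mem_rev mem_enum.
Qed.

Section Generator.
Variables (A : {set 'I_n}) (beta : seq idx) (q : nat) (I J : q.-tuple 'I_n).
Hypothesis (beta_size : size beta = (n - #|A|)%N) (J_uniq : uniq J) (JA : {subset J <= A}).

Let gen_list : seq ('I_n * (idx + 'I_n)) :=
  [seq (i, wl) | i <- enum (A :\: [set j in J])] ++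
  [seq (z.1, inl z.2) | z <- zip (enum (~: A)) beta] ++
  [seq (tnth J a, inr (tnth I a)) | a <- enum 'I_q].

Let size_compl : size (enum (~: A)) = size beta.
Proof. by rewrite -cardE cardsCs setCK card_ord beta_size. Qed.

Let gen_listE : unzip1 gen_list = enum (A :\: [set j in J]) ++ enum (~: A) ++ J.
Proof.
rewrite /gen_list /unzip1 !map_cat -[in LHS](map_comp _ _ (enum 'I_q)).
congr (_ ++ (_ ++ _)).
- by rewrite -map_comp map_id.
- by rewrite -map_comp -[RHS](unzip1_zip (eq_leq size_compl)).
exact: map_tnth_enum J.
Qed.

Let gen_list_uniq : uniq (unzip1 gen_list).
Proof.
rewrite gen_listE !cat_uniq !enum_uniq J_uniq /= andbT; apply/andP; split.
  apply/hasPn => j; rewrite mem_cat !mem_enum !inE => /orP[jA|jJ].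
    by rewrite (negPf jA) andbF.
  by rewrite jJ.
by apply/hasPn => j /JA jA; rewrite mem_enum inE jA.
Qed.

Let gen_list_mem j : j \in unzip1 gen_list.
Proof.
rewrite gen_listE !mem_cat !mem_enum !inE.
by case: (j \in J); case: (j \in A); rewrite ?orbT.
Qed.

Let gen : K := \prod_(i in A :\: [set j in J]) kriz_p i w * kriz_pbeta A beta
            * \prod_(a < q) kriz_G H (tnth I a) (tnth J a).

Let genE : gen = \prod_(c <- gen_list) L c.1 c.2.
Proof.
rewrite /gen_list !big_cat /= mulrA; congr (_ * _ * _); rewrite big_map //.
  exact: prod_enum.
by rewrite enumT [index_enum _]unlock.
Qed.

Lemma generator_word (s : fn) :
  (forall i, i \in A -> i \notin J -> s i = wl) ->
  (forall z, z \in zip (enum (~: A)) beta -> s z.1 = inl z.2) ->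
  (forall a, s (tnth J a) = inr (tnth I a)) -> eq_sign gen (word s).
Proof.
move=> sA sB sJ; rewrite genE; apply: assoc_word => // c.
rewrite !mem_cat => /or3P[] /mapP[i + ->] /=.
- by rewrite mem_enum !inE => /andP[iJ iA]; apply: sA.
- exact: sB.
by move=> _; apply: sJ.
Qed.

Lemma generator_fn_exists : exists s : fn,
  [/\ forall i, i \in A -> i \notin J -> s i = wl,
      forall z, z \in zip (enum (~: A)) beta -> s z.1 = inl z.2 &
      forall a, s (tnth J a) = inr (tnth I a)].
Proof.
(* [s] looks up the letter at [j] in the list. Every vertex occurs exactly once, so the default is
   never returned. *)
pose s : fn := [ffun j => (nth (j, wl) gen_list (index j (unzip1 gen_list))).2].
have sE c : c \in gen_list -> s c.1 = c.2.
  move=> cl; rewrite ffunE; set k := index _ _.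
  have kE : k = index c gen_list.
    rewrite /k -{1}(nth_index c cl) -(nth_map c c.1) ?index_mem //.
    by rewrite index_uniq // size_map index_mem.
  by rewrite kE (set_nth_default c) ?index_mem // nth_index.
exists s; split=> [i iA iJ|z zb|a].
- apply: (sE (i, wl)); rewrite !mem_cat; apply/orP; left.
  by apply/mapP; exists i; rewrite // mem_enum !inE iJ iA.
- apply: (sE (z.1, inl z.2)); rewrite !mem_cat; apply/or3P; apply: Or32.
  by apply/mapP; exists z.
apply: (sE (tnth J a, inr (tnth I a))); rewrite !mem_cat; apply/or3P; apply: Or33.
by apply/mapP; exists a; rewrite // mem_enum.
Qed.

End Generator.

Lemma generator_good_span (A : {set 'I_n}) (beta : seq idx) q (g : K) :
  (1 < #|A|)%N -> size beta = (n - #|A|)%N -> ord_max \notin beta ->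
  kriz_top_generator A beta q g -> good_span g.
Proof.
move=> A2 bs bmax [I [J [Js IJ IA JA ->]]].
have Ju : uniq J.
  by rewrite -(map_inj_uniq val_inj); apply: sorted_uniq Js;
    [apply: ltn_trans | apply: ltnn].
have [s [sA sB sJ]] := generator_fn_exists I bs Ju JA.
apply: (good_span_sign (generator_word bs Ju JA sA sB sJ)); apply: good_span_word.
have sC j : j \notin A -> exists2 k, s j = inl k & k != ord_max.
  move=> jA; have jz : j \in unzip1 (zip (enum (~: A)) beta).
    by rewrite unzip1_zip ?mem_enum ?inE // -cardE cardsCs setCK card_ord bs.
  have /mapP[z zb ->] := jz; exists z.2; first exact: sB.
  apply: contraNneq bmax => <-.
  have : z.2 \in unzip2 (zip (enum (~: A)) beta) by apply: map_f.
  by rewrite unzip2_zip // -cardE cardsCs setCK card_ord bs.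
(* The rooted vertices are exactly those of [A], because [beta] does not contain [w]. *)
have rA j : rooted s j = (j \in A).
  rewrite /rooted; have [jA|/sC[k -> /negPf//]] := boolP (j \in A).
  have [jJ|jJ] := boolP (j \in J); last by rewrite sA // eqxx.
  by have /tnthP[a ->] := jJ; rewrite sJ.
have sR j i : s j = inr i -> [/\ (i < j)%N & i \in A].
  move=> sj; have jA : j \in A by rewrite -rA /rooted sj.
  have [jJ|jJ] := boolP (j \in J); last by move: sj; rewrite sA.
  have /tnthP[a aE] := jJ; move: sj; rewrite aE sJ => -[<-]; split; first exact: IJ.
  by apply: IA; apply: mem_tnth.
apply/and3P; split.
- by apply/forallP => j; case sj: (s j) => [//|i]; have [] := sR _ _ sj.
- by apply/forallP => j; case sj: (s j) => [//|i]; have [_] := sR _ _ sj; rewrite rA.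
by rewrite (eq_card (B := A)) // => j; rewrite inE rA.
Qed.

Lemma kriz_w_good (x : K) : kriz_w B x -> good_span x.
Proof.
move: x; apply: lspan_sub => x [a [beta [/andP[a2 an] bsize bmax]]].
move: x; apply: lspan_sub => x [A [beta' [Aa bb']]].
move: x; apply: lspan_sub => x [q qA].
move: x; apply: lspan_sub => g; apply: generator_good_span; rewrite ?Aa //.
  by rewrite (perm_size bb').
by rewrite (perm_mem bb').
Qed.

Lemma good_word_kriz_w (s : fn) : good s -> kriz_w B (word s).
Proof.
move=> gs; have /and3P[vs cs s2] := gs.
pose A := [set j | rooted s j].
pose isG j := if s j is inr _ then true else false.
pose Jl := filter isG (enum 'I_n).
pose J := in_tuple Jl.
(* The defaults [j] here and [ord0] in [beta] are never taken: vertices in [J] carry an edge, and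
   unrooted vertices carry a class. *)
pose I := map_tuple (fun j => if s j is inr i then i else j) J.
pose beta : seq idx := [seq if s j is inl k then k else ord0 | j <- enum (~: A)].
have Ju : uniq J by rewrite filter_uniq ?enum_uniq.
have memJ j : (j \in J) = isG j by rewrite mem_filter mem_enum andbT.
have JA : {subset J <= A}.
  by move=> j; rewrite memJ /isG inE /rooted; case: (s j).
have sJ a : s (tnth J a) = inr (tnth I a).
  by rewrite tnth_map; have := mem_tnth a J; rewrite memJ /isG; case: (s _).
have bs : size beta = (n - #|A|)%N.
  by rewrite size_map -cardE cardsCs setCK card_ord.
have gE := @generator_word A beta (size Jl) I J bs Ju JA s.
have bmax : ord_max \notin beta.
  apply/mapP => -[j]; rewrite mem_enum !inE /rooted.
  by case: (s j) => [k kmax kE|//]; rewrite kE eqxx in kmax.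
have nA : (#|A| <= n)%N by rewrite -[X in (_ <= X)%N]card_ord max_card.
have wS : kriz_w B (\prod_(i in A :\: [set j in J]) kriz_p i w * kriz_pbeta A beta
            * \prod_(a < size Jl) kriz_G H (tnth I a) (tnth J a)).
  apply: lspan_in; exists #|A|, beta; split=> //; first by rewrite nA andbT.
  apply: lspan_in; exists A, beta; split=> //.
  apply: lspan_in; exists (size Jl).
    rewrite -(card_uniqP Ju); apply: proper_card; apply/properP; split.
      by apply/subsetP.
    (* The least rooted vertex carries [w], so [J] is a proper subset of [A] and [q < #|A|]. *)
    have /card_gt0P[j1 _] : (0 < #|A|)%N by apply: ltnW.
    have [ru _ _ _] := leastP j1 gs.
    by exists (least j1 0 s); rewrite ?inE // memJ /isG good_u.
  apply: lspan_in; exists I, J; split=> //.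
  - rewrite sorted_map; apply: sorted_filter; first by move=> ? ? ?; apply: ltn_trans.
    by rewrite -sorted_map val_enum_ord iota_ltn_sorted.
  - by move=> a; have /(validP vs) := sJ a.
  - by move=> i /tnthP[a ->]; rewrite inE; apply: closed_fnP cs (sJ a).
have [e ->] : eq_sign (word s) (\prod_(i in A :\: [set j in J]) kriz_p i w * kriz_pbeta
  A beta
            * \prod_(a < size Jl) kriz_G H (tnth I a) (tnth J a) : K).
  apply: eq_sign_sym; apply: gE => //.
    move=> i; rewrite memJ inE /rooted /isG; case: (s i) => // k /eqP->//.
  move=> z; rewrite -[enum (~: A)]map_id /beta zip_map => /mapP[j].
  rewrite mem_enum !inE /rooted => jA -> /=; by case: (s j) jA.
exact: lspanZ.
Qed.

Lemma good_kriz_w (x : K) : good_span x -> kriz_w B x.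
Proof. by move: x; apply: lspan_sub => _ [s gs ->]; apply: good_word_kriz_w. Qed.

Lemma word_bideg (s : fn) : exists q k, kriz_bideg q k (word s).
Proof.
suff [q [k qk]] : exists q k, kriz_monomial q k (word s).
  by exists q, k; apply: lspan_in.
rewrite /word_of; elim: (rev _) => [|j l [q [k IHl]]].
  by exists 0%N, 0%N; rewrite big_nil; apply: monomial_1.
rewrite big_cons; case: (s j) => [a|i] /=.
  by exists q, (hb_deg a + k)%N; apply: monomial_p IHl; apply: hb_homog.
by exists q.+1, (m.*2.-1 + k)%N; apply: monomial_G.
Qed.

End WordsOfGenerators.

(** * The subcomplex, its acyclicity and its invariance *)

Theorem proposition5p7 (m n : nat) (hm : (1 <= m)%N) (hn : (2 <= n)%N)
    (H : cohomology_ring m) (B : homogeneous_basis H)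
    (d : {linear kriz H n -> kriz H n}) (hd : kriz_differential B d)
    (act : 'S_n -> {lrmorphism kriz H n -> kriz H n})
    (hact : kriz_action act) :
  [/\ subcomplex d (@kriz_w m H n B), acyclic d (@kriz_w m H n B)
    & invariant_under act (@kriz_w m H n B)].
Proof.
have S := kriz_is_system H n.
have [dE0 dG dL] := hd.
have d1 : d 1 = 0.
  by apply: (dE0 0%N); apply: lspan_in; apply: monomial_1.
have d_p i k y : d (kriz_p i (tnth (hb_elt B) k) * y) =
    (-1) ^+ hb_deg k *: (kriz_p i (tnth (hb_elt B) k) * d y).
  (* A pulled back class has no exterior generator, so [d] kills it and only the second Leibniz term
     remains. *)
  have b : kriz_bideg 0 (hb_deg k) (kriz_p i (tnth (hb_elt B) k)).
    apply: lspan_in; rewrite -[X in kriz_monomial _ _ X]mulr1 -[hb_deg k]addn0.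
    by apply: monomial_p (monomial_1 _ _); apply: hb_homog.
  by rewrite (dL _ _ _ _ b) (dE0 _ _ b) mul0r add0r sign_scale.
have d_G i j y : i != j -> d (kriz_G H i j * y) =
    diag B (@kriz_p m H n) i j * y - kriz_G H i j * d y.
  move=> ij; have b : kriz_bideg 1 m.*2.-1 (kriz_G H i j).
    apply: lspan_in; rewrite -[X in kriz_monomial _ _ X]mulr1 -[m.*2.-1]addn0.
    by apply: monomial_G (monomial_1 _ _).
  by rewrite (dL _ _ _ _ b) dG // -signr_odd odd_double_pred // expr1 mulN1r.
have [f [f_lin f_word]] := kriz_coefficients B hm n.
(* A default for [least]; there is a vertex since $n\ge2$. *)
pose j0 : 'I_n := Ordinal (ltnW hn).
split.
- split.
  + exact: lspan0.
  + by move=> a x y; apply: lspan_lin.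
  (* Each good word is bihomogeneous and lies in the space, so the space is graded. *)
  + move=> x /kriz_w_good; move: x; apply: lspan_sub => _ [s gs ->].
    by apply: lspan_in; split; [apply: good_word_kriz_w | apply: word_bideg].
  move=> x /kriz_w_good sx; apply: good_kriz_w.
  exact: (good_span_d S d1 d_p d_G j0).
- move=> x /kriz_w_good sx dx.
  have [y sy dy] := good_span_acyclic S d1 d_p d_G j0 f_lin f_word sx dx.
  by exists y => //; apply: good_kriz_w.
move=> s x /kriz_w_good sx; apply: good_kriz_w.
have [act_p act_G] := hact; exact: (good_span_act S act_p act_G).
Qed.
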